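(* Fix a prime number $K>2$ and let $d\ge 1$. Then there is a constant $C(d,K)$ with $$C(d,K)\le (K+1)^d\,\mathrm{BH}^{\le d}_{\Omega_K}$$ such that for every $n\ge 1$ and every $A\in M_K(\mathbf{C})^{\otimes n}$ of degree-$d$ (with respect to the Heisenberg--Weyl basis), $$\|\widehat{A}\|_{\frac{2d}{d+1}}\le C(d,K)\,\|A\|.$$ In particular, we may choose $C(d,K)=C_K^{d^2}$ for some constant $C_K>0$ depending only on $K$.
   Context: Let $\omega=e^{2\pi i/K}$, and let $\{e_j:j\in\mathbb{Z}_K\}$, $\mathbb{Z}_K=\{0,1,\dots,K-1\}$, be the standard basis of $\mathbf{C}^K$. The operators $X,Z\in M_K(\mathbf{C})$ are defined by $Xe_j=e_{j+1}$ (index mod $K$) and $Ze_j=\omega^je_j$. The Heisenberg--Weyl matrices $\{X^\ell Z^m\}_{\ell,m\in\mathbb{Z}_K}$ form a basis of $M_K(\mathbf{C})$ (orthonormal for the normalized trace). Every $A\in M_K(\mathbf{C})^{\otimes n}$ has a unique expansion $$A=\sum_{\vec\ell,\vec m\in\mathbb{Z}_K^n}\widehat{A}(\vec\ell,\vec m)\,X^{\ell_1}Z^{m_1}\otimes\cdots\otimes X^{\ell_n}Z^{m_n},\qquad \widehat A(\vec\ell,\vec m)\in\mathbf{C}.$$ $A$ is of degree-$d$ if $\widehat{A}(\vec\ell,\vec m)=0$ whenever $\sum_{j=1}^n(\ell_j+m_j)>d$, where $0\le \ell_j,m_j\le K-1$ and the sum is of integers (not mod $K$). Put $\|\widehat{A}\|_p=\big(\sum_{\vec\ell,\vec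 m}|\widehat{A}(\vec\ell,\vec m)|^p\big)^{1/p}$, and let $\|A\|$ be the operator norm. $\mathrm{BH}^{\le d}_{\Omega_K}$ denotes the best (smallest) constant $C$ such that for all $n\ge1$ and all $f(z)=\sum_{\alpha\in\{0,\dots,K-1\}^n,\,|\alpha|\le d}a_\alpha z^\alpha$ on $\Omega_K^n$ one has $\big(\sum_\alpha|a_\alpha|^{2d/(d+1)}\big)^{(d+1)/(2d)}\le C\sup_{z\in\Omega_K^n}|f(z)|$; here $\Omega_K=\{1,\omega,\dots,\omega^{K-1}\}$, $z^\alpha=z_1^{\alpha_1}\cdots z_n^{\alpha_n}$ and $|\alpha|=\alpha_1+\dots+\alpha_n$. *)

(* Defs.v *)
From HB Require Import structures.
From mathcomp Require Import all_boot all_order all_algebra.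
From mathcomp Require Import all_classical all_reals all_analysis.
From mathcomp Require Import complex.

Set Implicit Arguments.
Unset Strict Implicit.
Unset Printing Implicit Defensive.
Import Order.TTheory GRing.Theory Num.Theory.
Local Open Scope classical_set_scope.
Local Open Scope complex_scope.
Local Open Scope ring_scope.

Definition omega (R : realType) (K : nat) : R[i] :=
  cos (2 * pi / K%:R) +i* sin (2 * pi / K%:R).

Definition modulus (R : realType) (z : R[i]) : R := Normc.normc z.

(* The multi-indices Z_K^n; they also label the standard basis
   e_{s_1} (x) ... (x) e_{s_n} of (C^K)^{(x) n}. *)
Notation midx K n := {ffun 'I_n -> 'I_K} (only parsing).

Definition lpnorm (R : realType) (I : finType) (p : R) (P : pred I)
    (a : I -> R[i]) : R :=
  (\sum_(i | P i) modulus (a i) `^ p) `^ (p^-1).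

Definition bh_exponent (R : realType) (d : nat) : R :=
  (2 * d)%:R / (d.+1)%:R.

(* M_K(C)^{(x) n}, as matrices in the standard basis; row and column numbers
   are turned into multi-indices by [enum_val]. *)
Notation tensM R K n := ('M[R[i]]_#|{: midx K n}|) (only parsing).

(* B_1 (x) ... (x) B_n, i.e. the n-fold Kronecker product. *)
Definition tensor (R : realType) (K n : nat) (B : 'I_n -> 'M[R[i]]_K) :
    tensM R K n :=
  \matrix_(s, t) \prod_(i < n)
    B i ((enum_val s : midx K n) i) ((enum_val t : midx K n) i).

(* Matrices act on column vectors: column j of X is e_{j+1}. *)
Definition hwX (R : realType) (K : nat) : 'M[R[i]]_K :=
  \matrix_(i, j) (i == ordS j)%:R.

Definition hwZ (R : realType) (K : nat) : 'M[R[i]]_K :=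
  diag_mx (\row_j (omega R K ^+ j)).

Definition heisenberg_weyl (R : realType) (K n : nat) (l m : midx K n) :
    tensM R K n :=
  tensor (fun i => hwX R K ^+ l i *m hwZ R K ^+ m i).

Definition hw_expansion (R : realType) (K n : nat) (A : tensM R K n)
    (Ahat : midx K n * midx K n -> R[i]) : Prop :=
  A = \sum_(l : midx K n) \sum_(m : midx K n)
        Ahat (l, m) *: heisenberg_weyl R l m.

Definition hw_degree (R : realType) (K n d : nat)
    (Ahat : midx K n * midx K n -> R[i]) : Prop :=
  forall l m : midx K n,
    (d < \sum_(i < n) (l i + m i))%N -> Ahat (l, m) = 0.

Definition l2norm (R : realType) (N : nat) (v : 'cV[R[i]]_N) : R :=
  Num.sqrt (\sum_(i < N) modulus (v i 0) ^+ 2).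

Definition opnorm (R : realType) (N : nat) (A : 'M[R[i]]_N) : R :=
  sup [set l2norm (A *m v) | v in [set v | l2norm v <= 1]].

(* C is admissible in the Heisenberg--Weyl inequality of degree d. The family
   Ahat is determined by A, the Heisenberg--Weyl matrices being a basis. *)
Definition hw_bh_bound (R : realType) (K d : nat) (C : R) : Prop :=
  forall (n : nat) (A : tensM R K n) (Ahat : midx K n * midx K n -> R[i]),
    (1 <= n)%N -> hw_expansion A Ahat -> hw_degree d Ahat ->
    lpnorm (bh_exponent R d) predT Ahat <= C * opnorm A.

Definition Omega (R : realType) (K : nat) : set R[i] :=
  [set omega R K ^+ j | j in `I_K].

Definition low_degree (K n d : nat) : pred (midx K n) :=
  fun alpha => (\sum_(i < n) alpha i <= d)%N.

Definition poly_eval (R : realType) (K n d : nat) (a : midx K n -> R[i])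
    (z : 'I_n -> R[i]) : R[i] :=
  \sum_(alpha | low_degree d alpha) a alpha * \prod_(i < n) z i ^+ alpha i.

Definition Omega_supnorm (R : realType) (K n d : nat) (a : midx K n -> R[i]) :
    R :=
  sup [set modulus (poly_eval d a z) |
        z in [set z : 'I_n -> R[i] | forall i, Omega K (z i)]].

Definition cyclic_bh_bound (R : realType) (K d : nat) (C : R) : Prop :=
  forall (n : nat) (a : midx K n -> R[i]), (1 <= n)%N ->
    lpnorm (bh_exponent R d) (@low_degree K n d) a <= C * Omega_supnorm d a.

(* The best constant BH^{<= d}_{Omega_K}; taken in the extended reals so that no
   junk value arises should no constant be admissible. *)
Definition BH_Omega (R : realType) (K d : nat) : \bar R :=
  ereal_inf [set C%:E | C in [set C : R | cyclic_bh_bound K d C]].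

(* Main.v *)
(* A degree-[d] polynomial [f] on [Omega_K^n] extends to
   [F(v) = sum_alpha a_alpha prod_j v_j(alpha_j)], where the powers [z_j^k] are
   replaced by independent variables [v_j(k)], [v_j(0) = 1]. Each [v_j] is the
   Fourier transform of a complex measure on [Z_K], which is a combination, with
   weights that do not depend on [j], of three probability measures. Drawing one
   of the three for each of [d] slots and giving every coordinate the average of
   its laws over a set [U] of slots, one recovers [F(v)] from averages of [f] by
   the polarization formula over [U]; only the [d] slots, not the [n]
   coordinates, contribute to the constant, so [|F(v)| <= (26 K d)^d ||f||] for
   [|v| <= 2].

   Differentiating [F] at [v_j(k) = z_j^k] bounds the sum over [(j, k)] of the
   moduli of the parts [G_(j,k)(z)] of [f] with [alpha_j = k]. On the
   [2K]-th roots of unity the fourth moment of [G_(j,k)] is at most [4^d] times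
   the square of its second moment, hence its 2-norm is at most [2^(d+1)] times
   its 1-norm, and an inequality of Blei's type, a pointwise AM-GM, turns the
   resulting bound on the sum of the 2-norms into the one on the
   [2d/(d+1)]-norm of the coefficients.

   For the Heisenberg--Weyl matrices, the [K + 1] lines of [Z_K^2] index the
   maximal commuting families. Averaging [<v| A |v>] over the product vectors
   [v] whose factors are eigenvectors of such families gives a polynomial in the
   eigenvalues, bounded by the operator norm of [A], of degree at most [d], and
   whose coefficients are those of [A] up to a phase and a factor at least
   [(K + 1)^-d]. *)
Require Import Defs.
From mathcomp Require Import all_boot all_order all_algebra.
From mathcomp Require Import all_classical all_reals all_analysis.
From mathcomp Require Import complex.
From mathcomp Require Import ring lra zify.

Set Implicit Arguments.
Unset Strict Implicit.
Unset Printing Implicit Defensive.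
Import Order.TTheory GRing.Theory Num.Theory.
Local Open Scope complex_scope.
Local Open Scope ring_scope.

(** * The modulus *)

Section Modulus.
Variable R : realType.
Implicit Types z w : R[i].

Lemma norm_modulus z : `|z| = (modulus z)%:C.
Proof. by rewrite normc_def; case: z. Qed.

Lemma modulus0 : modulus (0 : R[i]) = 0.
Proof. exact: Normc.normc0. Qed.

Lemma modulus1 : modulus (1 : R[i]) = 1.
Proof. exact: Normc.normc1. Qed.

Lemma modulus_ge0 z : 0 <= modulus z.
Proof. by case: z => a b; rewrite /modulus /Normc.normc sqrtr_ge0. Qed.

Lemma modulus_eq0 z : modulus z = 0 -> z = 0.
Proof. exact: Normc.eq0_normc. Qed.

Lemma modulusM : {morph @modulus R : z w / z * w}.
Proof. exact: Normc.normcM. Qed.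

Lemma modulusD z w : modulus (z + w) <= modulus z + modulus w.
Proof. exact: le_normcD. Qed.

Lemma modulusN z : modulus (- z) = modulus z.
Proof. exact: normcN. Qed.

Lemma modulusV z : modulus z^-1 = (modulus z)^-1.
Proof. exact: Normc.normcV. Qed.

Lemma modulusX n z : modulus (z ^+ n) = modulus z ^+ n.
Proof.
by elim: n => [|n IHn]; rewrite ?expr0 ?modulus1 // !exprS modulusM IHn.
Qed.

Lemma modulus_sum (I : Type) (r : seq I) (P : pred I) (F : I -> R[i]) :
  modulus (\sum_(i <- r | P i) F i) <= \sum_(i <- r | P i) modulus (F i).
Proof.
elim/big_ind2: _ => [|x1 x2 y1 y2 h1 h2|//]; first by rewrite modulus0.
exact: le_trans (modulusD _ _) (lerD h1 h2).
Qed.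

Lemma modulus_prod (I : Type) (r : seq I) (P : pred I) (F : I -> R[i]) :
  modulus (\prod_(i <- r | P i) F i) = \prod_(i <- r | P i) modulus (F i).
Proof. exact: (big_morph _ modulusM modulus1). Qed.

Lemma modulus_real (x : R) : modulus x%:C = `|x|.
Proof. by rewrite /modulus /= expr0n addr0 sqrtr_sqr. Qed.

Lemma modulus_nat n : modulus (n%:R : R[i]) = n%:R.
Proof. by rewrite -(rmorph_nat (real_complex R)) modulus_real normr_nat. Qed.

Lemma modulus_conj z : modulus (z^*)%C = modulus z.
Proof. by apply: complexI; rewrite -!norm_modulus normcJ. Qed.

Lemma modulus_sqr z : (modulus z ^+ 2)%:C = z * (z^*)%C.
Proof. by rewrite -sqr_normc norm_modulus rmorphXn. Qed.

Lemma ler_Re_modulus z : `|complex.Re z| <= modulus z.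
Proof. by rewrite -lecR -norm_modulus normc_ge_Re. Qed.

Lemma ler_Im_modulus z : `|complex.Im z| <= modulus z.
Proof.
have := ler_Re_modulus (z * 'i%C).
by rewrite ReiNIm normrN modulusM {3}/modulus /= expr0n add0r expr1n sqrtr1 mulr1.
Qed.

Lemma phaseE z : exists2 u : R[i], modulus u = 1 & u * z = (modulus z)%:C.
Proof.
have [->|z0] := eqVneq z 0.
  by exists 1; [exact: modulus1|rewrite mulr0 modulus0].
have m0 : modulus z != 0 by apply: contra_neq z0 => /modulus_eq0.
exists ((z^*)%C * (modulus z)%:C^-1).
  rewrite modulusM modulusV modulus_conj modulus_real ger0_norm ?modulus_ge0//.
  by rewrite divff.
rewrite mulrAC [_ * z]mulrC -modulus_sqr expr2 rmorphM /= mulfK //.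
by rewrite -(rmorph0 (real_complex R)) (inj_eq (@complexI R)).
Qed.

End Modulus.

(** * Roots of unity *)

Section RootsOfUnity.
Variable R : realType.

Lemma omegaX (N k : nat) :
  omega R N ^+ k = cos (2 * pi / N%:R *+ k) +i* sin (2 * pi / N%:R *+ k).
Proof.
elim: k => [|k IHk]; first by rewrite expr0 mulr0n cos0 sin0.
rewrite exprSr IHk [_ *+ k.+1]mulrSr cosD sinD /omega.
by apply/eqP; rewrite eq_complex /= !eqxx /= addrC eqxx.
Qed.

Lemma omega_order (N : nat) : (0 < N)%N -> omega R N ^+ N = 1.
Proof.
move=> N0; rewrite omegaX -mulr_natr -mulrA mulVf ?mulr1 ?pnatr_eq0 -?lt0n //.
by rewrite mulr_natl cos2pi sin2pi.
Qed.

(** With [t = pi k / N] strictly between 0 and [pi], [cos (2 t) = 1] would force [sin t = 0]. *)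
Lemma omega_neq1 (N k : nat) : (0 < k < N)%N -> omega R N ^+ k != 1.
Proof.
move=> /andP[k0 kN]; rewrite omegaX; apply/negP => /eqP [cos1 _].
set t := pi / N%:R *+ k : R.
have N0 : 0 < N%:R :> R by rewrite ltr0n (leq_trans _ kN).
have t2 : 2 * pi / N%:R *+ k = t *+ 2 :> R.
  by rewrite /t -mulrnA mulnC mulrnA; congr (_ *+ _); rewrite -mulrA mulr_natl.
have sin_t : 0 < sin t.
  apply: sin_gt0_pi; apply/andP; split; last first.
    rewrite /t -[_ *+ k]mulr_natr mulrAC ltr_pdivrMr ?ltr_pM2l ?pi_gt0 ?ltr_nat//.
  by rewrite /t pmulrn_lgt0 // divr_gt0 ?pi_gt0.
have := cos2Dsin2 t; move: cos1; rewrite t2 cos_mulr2n => cos1.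
have := exprn_gt0 2 sin_t.
by move: cos1; rewrite mulr2n => c1 s0 c2; lra.
Qed.

Lemma modulus_omega (N : nat) : modulus (omega R N) = 1.
Proof. by rewrite /modulus /= cos2Dsin2 sqrtr1. Qed.

Lemma omega_neq0 (N : nat) : omega R N != 0.
Proof.
by apply/eqP => h; have := modulus_omega N; rewrite h modulus0 => /esym/eqP; rewrite oner_eq0.
Qed.

Lemma conj_omegaX (N k : nat) : ((omega R N ^+ k)^*)%C = omega R N ^- k.
Proof.
have h := modulus_sqr (omega R N ^+ k).
rewrite modulusX modulus_omega !expr1n in h.
by apply: (mulfI (expf_neq0 k (omega_neq0 N))); rewrite -h divff // expf_neq0 // omega_neq0.
Qed.

Lemma omegaX_mod (N k : nat) : (0 < N)%N -> omega R N ^+ (k %% N) = omega R N ^+ k.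
Proof. by move=> /omega_order h; rewrite expr_mod. Qed.

Lemma sum_omegaX (N k : nat) : (0 < N)%N ->
  \sum_(x < N) omega R N ^+ (k * x) = if (N %| k)%N then N%:R else 0.
Proof.
move=> N0; case: ifPn => [/dvdnP[q ->]|Nk].
  rewrite (eq_bigr (fun=> 1)) => [|x _]; last first.
    by rewrite -mulnA mulnCA exprM omega_order // expr1n.
  by rewrite sumr_const card_ord.
have neq1 : omega R N ^+ k != 1.
  rewrite -omegaX_mod // omega_neq1 // ltn_pmod // andbT lt0n.
  by apply: contra Nk => /eqP h; rewrite /dvdn h.
apply: (mulfI (x := omega R N ^+ k - 1)); first by rewrite subr_eq0.
rewrite mulr0; under eq_bigr do rewrite exprM.
by rewrite -subrX1 -exprM mulnC exprM omega_order // expr1n subrr.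
Qed.

Lemma sum_omega_orthogonal (N j k : nat) : (j < N)%N -> (k < N)%N ->
  \sum_(x < N) omega R N ^+ (j * x) * omega R N ^- (k * x) =
  if j == k then N%:R else 0.
Proof.
move=> jN kN; have N0 : (0 < N)%N by apply: leq_trans jN.
have E (x : 'I_N) : omega R N ^+ (j * x) * omega R N ^- (k * x) =
    omega R N ^+ ((j + (N - k)) * x).
  apply: (mulIf (expf_neq0 (k * x) (omega_neq0 N))).
  rewrite mulfVK ?expf_neq0 ?omega_neq0 // -exprD -mulnDl.
  rewrite -addnA subnK; last exact: ltnW.
  by rewrite mulnDl exprD [omega R N ^+ (N * x)]exprM omega_order // expr1n mulr1.
rewrite (eq_bigr _ (fun x _ => E x)) sum_omegaX //; congr (if _ then _ else _).
apply/idP/eqP => [|->]; last by rewrite subnKC ?dvdnn // ltnW.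
(* The exponent [j + (N - k)] lies strictly between 0 and [2 N], so the quotient can only be 1, that
   is [j = k]. *)
move/dvdnP=> [[|[|q]]]; nia.
Qed.

End RootsOfUnity.

(** * Extension from roots of unity to independent variables *)

Section Polarization.
Variable A : comNzRingType.

Lemma injectiveb_codom d (k : {ffun 'I_d -> 'I_d}) :
  injectiveb k = [forall l, l \in codom k].
Proof.
apply/injectiveP/forallP => [k_inj l|onto].
  by rewrite (inj_card_onto k_inj).
suff : {in predT &, injective k} by move=> h x y; apply: h.
apply/image_injP/eqP/eq_card => x; rewrite inE; exact: onto.
Qed.

(* Ryser's formula, by inclusion-exclusion over the image of [k]. *)
Lemma polarization d (M : 'I_d -> 'I_d -> A) :
  \sum_(U : {set 'I_d}) (-1) ^+ #|~: U| * \prod_i \sum_(l in U) M i l =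
  \sum_(k : {ffun 'I_d -> 'I_d} | injectiveb k) \prod_i M i (k i).
Proof.
under eq_bigr do rewrite bigA_distr_big big_mkcond mulr_sumr.
rewrite exchange_big [RHS]big_mkcond /=; apply: eq_bigr => k _.
(* The sign and the condition that [U] contains the image of [k] merge into one product over [l]:
   the indicator kills every [U] that misses a point of the image. *)
transitivity (\sum_(U : {set 'I_d})
    \prod_l (if l \in U then 1 else - (l \notin codom k)%:R : A) *
    \prod_i M i (k i)).
  apply: eq_bigr => U _.
  have -> : \prod_l (if l \in U then 1 else - (l \notin codom k)%:R) =
      (-1) ^+ #|~: U| * \prod_(l | l \notin U) (l \notin codom k)%:R :> A.
    rewrite (bigID (fun l => l \in U)) /= big1 ?mul1r; last by move=> l ->.
    rewrite (eq_bigr (fun l => (-1) * (l \notin codom k)%:R)); last first.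
      by move=> l /negbTE->; rewrite mulN1r.
    rewrite big_split /= prodr_const; congr (_ ^+ _ * _).
    by apply: eq_card => l; rewrite !inE.
  rewrite -mulrA; congr (_ * _); case: ifPn => [/ffun_onP kU|].
    rewrite [X in _ = X * _]big1 ?mul1r // => l lU.
    case: (boolP (l \in codom k)) => // /codomP[x lx].
    by move: lU; rewrite lx kU.
  rewrite -[k \in _]/(k \in family _) inE negb_forall => /existsP[x xU].
  by rewrite (bigD1 (k x)) //= codom_f mul0r mul0r.
(* Summed over [U], the product has a factor 1 for each [l] in the image of [k] and [1 - 1] for each
   other [l], so only surjective [k] remain. *)
rewrite -mulr_suml -bigA_distr injectiveb_codom.
case: ifPn => [/forallP onto|/forallPn[l lk]].
  by rewrite big1 ?mul1r // => l _; rewrite onto /= subr0.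
by rewrite (bigD1 l) //= lk subrr !mul0r.
Qed.

(* When the entries of [r] are independent with complex law [w], an injective
   [k] makes the factors [Y i (r (k i))] independent. *)
Lemma polarization_expectation d (S : finType) (w : S -> A)
    (Y : 'I_d -> S -> A) :
  \sum_(r : {ffun 'I_d -> S}) (\prod_l w (r l)) *
    \sum_(U : {set 'I_d}) (-1) ^+ #|~: U| * \prod_i \sum_(l in U) Y i (r l) =
  #|[pred k : {ffun 'I_d -> 'I_d} | injectiveb k]|%:R *
    \prod_i \sum_s w s * Y i s.
Proof.
transitivity (\sum_(r : {ffun 'I_d -> S})
    \sum_(k : {ffun 'I_d -> 'I_d} | injectiveb k)
      (\prod_l w (r l)) * \prod_i Y i (r (k i))).
  by apply: eq_bigr => r _; rewrite (polarization (fun i l => Y i (r l))) mulr_sumr.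
rewrite exchange_big /= mulr_natl -sumr_const; apply: eq_bigr => k /injectiveP k_inj.
rewrite bigA_distr_bigA /=.
(* Composing [r] with the inverse of [k] keeps the product of the weights and turns [Y i (r (k i))]
   into [Y i (r i)]. *)
rewrite (reindex (fun r : {ffun 'I_d -> S} => [ffun i => r (invF k_inj i)])).
  apply: eq_bigr => r _; rewrite (reindex k) /=; last first.
    by apply: onW_bij; exists (invF k_inj); [exact: invF_f|exact: f_invF].
  by rewrite -big_split /=; apply: eq_bigr => i _; rewrite !ffunE invF_f.
apply: onW_bij; exists (fun r : {ffun 'I_d -> S} => [ffun i => r (k i)]) => r;
  by apply/ffunP => i; rewrite !ffunE ?f_invF ?invF_f.
Qed.

End Polarization.

Section Slots.
Variables K n : nat.
Implicit Types alpha : {ffun 'I_n -> 'I_K}.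

Definition supp alpha : {set 'I_n} := [set j | (0 < alpha j)%N].

Lemma leq_card_supp d alpha : low_degree d alpha -> (#|supp alpha| <= d)%N.
Proof.
apply: leq_trans; rewrite -sum1_card big_mkcond /=; apply: leq_sum => j _.
by rewrite inE; case: ifP.
Qed.

(* A support of size at most [d], padded with [None] to exactly [d] entries. *)
Definition slot d alpha (i : nat) : option 'I_n :=
  nth None ([seq Some j | j <- enum (supp alpha)] ++
            nseq (d - #|supp alpha|) None) i.

(** Brings a product over a support to exactly [d] factors, the shape that
    [polarization_expectation] requires. *)
Lemma big_slot (T : Type) (idx : T) (op : Monoid.com_law idx) d alpha
    (F : option 'I_n -> T) : (#|supp alpha| <= d)%N ->
  \big[op/idx]_(i < d) F (slot d alpha i) =
  op (\big[op/idx]_(j in supp alpha) F (Some j))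
     (iter (d - #|supp alpha|) (op (F None)) idx).
Proof.
move=> sd; rewrite -(big_mkord predT (fun i => F (slot d alpha i))).
have {1}-> : d = size ([seq Some j | j <- enum (supp alpha)] ++
            nseq (d - #|supp alpha|) None).
  by rewrite size_cat size_map size_nseq -cardE subnKC.
by rewrite -(big_nth None predT) big_cat big_map big_enum /= big_nseq.
Qed.

Lemma prod_supp (A : comNzRingType) alpha (F : 'I_n -> A) :
  (forall j, alpha j = 0 :> nat -> F j = 1) ->
  \prod_(j in supp alpha) F j = \prod_j F j.
Proof.
move=> F1; rewrite [RHS](bigID (fun j => j \in supp alpha)) /=.
rewrite [X in _ = _ * X]big1 ?mulr1 // => j; rewrite inE -eqn0Ngt => /eqP.
exact: F1.
Qed.

End Slots.

Section Extension.
Variable R : realType.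

(* A complex measure [c] of total mass 1 with values of modulus at most 2 is
   [(M + 1) p + i M p' - (M + i M) u], with [M = 3 K], [u] uniform and [p], [p']
   probabilities that perturb [u] by the real and imaginary parts of [c]. *)
Definition weight (K : nat) (s : 'I_3) : R[i] :=
  match val s with
  | 0%N => (3 * K + 1)%:R
  | 1%N => 'i%C * (3 * K)%:R
  | _ => - (3 * K)%:R - 'i%C * (3 * K)%:R
  end.

Lemma sum_modulus_weight K : (0 < K)%N ->
  \sum_s modulus (weight K s) <= (13 * K)%:R.
Proof.
move=> K0; rewrite !big_ord_recl big_ord0 /weight /=.
have mi : modulus ('i%C : R[i]) = 1.
  by rewrite /modulus /= expr0n add0r expr1n sqrtr1.
have h := modulusD (- (3 * K)%:R : R[i]) (- ('i%C * (3 * K)%:R)).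
rewrite !modulusN !modulusM mi !modulus_nat !mul1r in h *.
apply: le_trans (lerD (lexx _) (lerD (lexx _) (lerD h (lexx _)))) _.
by rewrite addr0 -!natrD ler_nat; lia.
Qed.

Lemma measure_split (K : nat) (c : 'I_K -> R[i]) : (0 < K)%N ->
  \sum_x c x = 1 -> (forall x, modulus (c x) <= 2) ->
  exists q : 'I_3 -> 'I_K -> R,
    [/\ forall s x, 0 <= q s x, forall s, \sum_x q s x = 1 &
        forall x, \sum_s weight K s * (q s x)%:C = c x].
Proof.
move=> K0 sum_c c_le2.
have K0R : 0 < K%:R :> R by rewrite ltr0n.
have K1R : 1 <= K%:R :> R by rewrite ler1n.
have Kinv : K%:R * K%:R^-1 = 1 :> R by rewrite divff // gt_eqF.
have sumV : \sum_(x < K) K%:R^-1 = 1 :> R.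
  by rewrite sumr_const card_ord -[LHS]mulr_natr mulVf // gt_eqF.
have sumRe : \sum_x complex.Re (c x) = 1.
  by rewrite -(raddf_sum (@complex.Re R : Rcomplex R -> R)) sum_c.
have sumIm : \sum_x complex.Im (c x) = 0.
  by rewrite -(raddf_sum (@complex.Im R : Rcomplex R -> R)) sum_c.
exists (fun s x => match val s with
  | 0%N => K%:R^-1 + (complex.Re (c x) - K%:R^-1) / (3 * K + 1)%:R
  | 1%N => K%:R^-1 + complex.Im (c x) / (3 * K)%:R
  | _ => K%:R^-1
  end).
have M0 : 0 < (3 * K + 1)%:R :> R by rewrite ltr0n addn1.
have M1 : 0 < (3 * K)%:R :> R by rewrite ltr0n muln_gt0.
split.
(* Multiplied by [3 K + 1] and [3 K], the first two laws become [3 + Re (c x)] and [3 + Im (c x)],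
   nonnegative since [c x] has modulus at most 2. *)
- move=> s x; have := ler_Re_modulus (c x); have := ler_Im_modulus (c x).
  rewrite !ler_norml => /andP[i1 i2] /andP[r1 r2]; have c2 := c_le2 x.
  have V0 : 0 < K%:R^-1 :> R by rewrite invr_gt0.
  have V1 : K%:R^-1 <= 1 :> R by rewrite invf_le1.
  case: s => [[|[|s]] sP] /=; last exact: ltW.
  + rewrite -(pmulr_lge0 _ M0) mulrDl mulfVK ?gt_eqF //.
    rewrite natrD natrM mulrDr mulrCA [_^-1 * _]mulrC Kinv; lra.
  + rewrite -(pmulr_lge0 _ M1) mulrDl mulfVK ?gt_eqF //.
    rewrite natrM mulrCA [_^-1 * _]mulrC Kinv; lra.
- case=> [[|[|s]] sP] /=; rewrite ?big_split /= sumV //.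
  + by rewrite -mulr_suml sumrB sumRe sumV subrr mul0r addr0.
  + by rewrite -mulr_suml sumIm mul0r addr0.
move=> x; rewrite /weight; move: M0 M1; move: (3 * K)%N => m.
have := natrD R[i] m 1; move: (m + 1)%N => m1 m1E M0 M1.
rewrite !big_ord_recl big_ord0 /= addr0 [c x in RHS]complexE.
rewrite !rmorphD /= !rmorphM /= rmorphB /= !fmorphV /= !rmorph_nat.
have kk : m%:R * m%:R^-1 = 1 :> R[i] by rewrite divff // pnatr_eq0 -lt0n -(ltr0n R).
have kk1 : m1%:R * m1%:R^-1 = 1 :> R[i] by rewrite divff // pnatr_eq0 -lt0n -(ltr0n R).
set u := K%:R^-1; set re := (complex.Re _)%:C; set im := (complex.Im _)%:C.
rewrite !mulrDr [m1%:R * (_ * _)]mulrCA kk1 -!mulrA [m%:R * (_ * _)]mulrCA kk m1E.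
ring.
Qed.

(** For independent coordinates, the [j]-th equal to [omega ^+ x] with probability [p j x], the sum
    is the expectation of [f]. *)
Lemma product_law_bound (K n d : nat) (a : {ffun 'I_n -> 'I_K} -> R[i]) (B : R)
    (p : 'I_n -> 'I_K -> R) :
  (forall z : 'I_n -> R[i], (forall j, Omega K (z j)) ->
    modulus (poly_eval d a z) <= B) ->
  (forall j x, 0 <= p j x) -> (forall j, \sum_x p j x = 1) ->
  modulus (\sum_(alpha | low_degree d alpha) a alpha *
    \prod_j \sum_x (p j x)%:C * omega R K ^+ (alpha j * x)) <= B.
Proof.
move=> fB p0 p1.
have -> : \sum_(alpha | low_degree d alpha) a alpha *
    \prod_j \sum_x (p j x)%:C * omega R K ^+ (alpha j * x) =
  \sum_(x : {ffun 'I_n -> 'I_K}) (\prod_j p j (x j))%:C *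
    poly_eval d a (fun j => omega R K ^+ x j).
  rewrite /poly_eval.
  under [RHS]eq_bigr do rewrite mulr_sumr.
  rewrite [RHS]exchange_big /=; apply: eq_bigr => alpha _.
  rewrite bigA_distr_bigA mulr_sumr; apply: eq_bigr => x _ /=.
  rewrite mulrCA big_split /= rmorph_prod; congr (_ * (_ * _)).
  by apply: eq_bigr => j _; rewrite -exprM mulnC.
apply: le_trans (modulus_sum _ _ _) _.
apply: (@le_trans _ _ (\sum_(x : {ffun 'I_n -> 'I_K}) (\prod_j p j (x j)) * B)).
  apply: ler_sum => x _; rewrite modulusM modulus_real.
  rewrite ger0_norm ?prodr_ge0 // ler_wpM2l ?prodr_ge0 //.
  by apply: fB => j; exists (val (x j)) => //=.
rewrite -mulr_suml -bigA_distr_bigA big1 ?mul1r //.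
Qed.

Lemma extension_bound (K n d : nat) (a : {ffun 'I_n -> 'I_K} -> R[i]) (B : R)
    (v : 'I_n -> 'I_K -> R[i]) :
  (0 < d)%N -> (0 < K)%N ->
  (forall z : 'I_n -> R[i], (forall j, Omega K (z j)) ->
    modulus (poly_eval d a z) <= B) ->
  (forall j (k : 'I_K), k = 0 :> nat -> v j k = 1) ->
  (forall j k, modulus (v j k) <= 2) ->
  modulus (\sum_(alpha | low_degree d alpha) a alpha * \prod_j v j (alpha j)) <=
    (26 * K * d)%:R ^+ d * B.
Proof.
move=> d0 K0 fB v1 v2.
have K0R : 0 < K%:R :> R by rewrite ltr0n.
have KC0 : K%:R != 0 :> R[i] by rewrite pnatr_eq0 -lt0n.
have B0 : 0 <= B.
  apply: le_trans (modulus_ge0 _) (fB (fun=> 1) _) => j.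
  by exists 0%N; rewrite //= expr0.
(* The measure whose Fourier transform is [v j]; its total mass is [v j 0 = 1], and its values are
   averages of [K] numbers of modulus at most 2. *)
pose c j (x : 'I_K) := K%:R^-1 * \sum_(k < K) v j k * omega R K ^- (k * x).
have c_inv j (k : 'I_K) : \sum_x c j x * omega R K ^+ (k * x) = v j k.
  rewrite /c; under eq_bigr do rewrite -mulrA mulr_suml.
  rewrite -mulr_sumr exchange_big /= (bigD1 k) //= [X in _ + X]big1 => [|k' k'k].
    rewrite addr0; under eq_bigr do rewrite -mulrA [_^-1 * _]mulrC.
    by rewrite -mulr_sumr sum_omega_orthogonal // eqxx mulrCA mulVf // mulr1.
  under eq_bigr do rewrite -mulrA [_^-1 * _]mulrC.
  rewrite -mulr_sumr sum_omega_orthogonal //.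
  by rewrite eq_sym (negbTE k'k : (k' == k :> nat) = false) mulr0.
have sum_c j : \sum_x c j x = 1.
  rewrite -(v1 j (Ordinal K0)) // -c_inv.
  by apply: eq_bigr => x _; rewrite mul0n expr0 mulr1.
have c_le2 j x : modulus (c j x) <= 2.
  rewrite /c modulusM modulusV modulus_nat ler_pdivrMl //.
  apply: le_trans (modulus_sum _ _ _) _.
  rewrite mulr_natl -[K in _ *+ K]card_ord -sumr_const; apply: ler_sum => k _.
  by rewrite modulusM modulusV modulusX modulus_omega expr1n invr1 mulr1.
have /choice[q qP] : forall j, exists q : 'I_3 -> 'I_K -> R,
    [/\ forall s x, 0 <= q s x, forall s, \sum_x q s x = 1 &
        forall x, \sum_s weight K s * (q s x)%:C = c j x].
  by move=> j; apply: measure_split.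
pose Q j s (k : nat) := \sum_x (q j s x)%:C * omega R K ^+ (k * x).
have Q0 j s : Q j s 0%N = 1.
  rewrite /Q; under eq_bigr do rewrite mul0n expr0 mulr1.
  by rewrite -rmorph_sum /=; have [_ -> _] := qP j.
have EQ j (k : 'I_K) : \sum_s weight K s * Q j s k = v j k.
  rewrite -c_inv /Q; under eq_bigr do rewrite mulr_sumr.
  rewrite exchange_big; apply: eq_bigr => x _ /=.
  by have [_ _ <-] := qP j; rewrite mulr_suml; apply: eq_bigr => s _; rewrite mulrA.
pose Y (alpha : {ffun 'I_n -> 'I_K}) (i : 'I_d) s :=
  if slot d alpha i is Some j then Q j s (alpha j) else 1 : R[i].
have sum_w : \sum_s weight K s = 1.
  by rewrite !big_ord_recl big_ord0 /weight /= addr0 natrD; ring.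
have EY alpha : low_degree d alpha ->
    \prod_i \sum_s weight K s * Y alpha i s = \prod_j v j (alpha j).
  move=> la; rewrite -(prod_supp (alpha := alpha)); last first.
    by move=> j /v1.
  pose F o := \sum_s weight K s *
    (if o is Some j then Q j s (alpha j) else 1).
  rewrite (big_slot _ F) ?leq_card_supp // iter_mulr_1.
  have -> : F None = 1 by rewrite /F; under eq_bigr do rewrite mulr1.
  by rewrite expr1n /= mulr1; apply: eq_bigr => j _; exact: EQ.
(* For fixed [U] and [r], averaging over [U] the laws drawn at coordinate [j] gives a probability
   law [p j], to which [product_law_bound] applies. For empty [U] the product vanishes, as
   [d > 0]. *)
have UB (U : {set 'I_d}) (r : {ffun 'I_d -> 'I_3}) :
    modulus (\sum_(alpha | low_degree d alpha)
      a alpha * \prod_i \sum_(l in U) Y alpha i (r l)) <= d%:R ^+ d * B.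
  have [->|U0] := eqVneq U finset.set0.
    rewrite big1 ?modulus0 ?mulr_ge0 ?exprn_ge0 // => alpha _.
    rewrite (_ : \prod_i _ = 0) ?mulr0 //; apply/eqP/prodf_eq0.
    by exists (Ordinal d0) => //; apply/eqP/big1 => l; rewrite inE.
  have U0R : 0 < #|U|%:R :> R by rewrite ltr0n card_gt0.
  have U0C : #|U|%:R != 0 :> R[i] by rewrite pnatr_eq0 -lt0n card_gt0.
  pose p j x := #|U|%:R^-1 * \sum_(l in U) q j (r l) x.
  have p0 j x : 0 <= p j x.
    rewrite mulr_ge0 ?invr_ge0 ?ler0n // sumr_ge0 // => l _.
    by have [] := qP j.
  have p1 j : \sum_x p j x = 1.
    rewrite -mulr_sumr exchange_big /= (eq_bigr (fun=> 1)) => [|l _]; last first.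
      by have [_ ->] := qP j.
    by rewrite sumr_const -[X in _ * X]mulr_natr mul1r mulVf // gt_eqF.
  have pQ j (k : nat) : \sum_x (p j x)%:C * omega R K ^+ (k * x) =
      #|U|%:R^-1 * \sum_(l in U) Q j (r l) k.
    rewrite /p /Q exchange_big /= mulr_sumr; apply: eq_bigr => x _.
    by rewrite rmorphM /= fmorphV /= rmorph_nat -mulrA -mulr_suml rmorph_sum.
  have := product_law_bound fB p0 p1.
  set S := (X in modulus X <= _) => SB; set S' := (X in modulus X <= _).
  (* Empty slots also contribute [#|U|], so the normalization is the same [#|U| ^+ d] for every
     [alpha]. *)
  have -> : S' = #|U|%:R ^+ d * S.
    rewrite /S /S' mulr_sumr; apply: eq_bigr => alpha la.
    rewrite mulrCA; congr (_ * _).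
    pose F o := \sum_(l in U) (if o is Some j then Q j (r l) (alpha j) else 1).
    rewrite (big_slot _ F) ?leq_card_supp // iter_mulr_1 /=.
    have -> : F None = #|U|%:R by rewrite /F sumr_const.
    have sd := leq_card_supp la.
    rewrite -[X in _ ^+ X * \prod_j _](subnK sd) exprD mulrC -mulrA; congr (_ * _).
    rewrite -(prod_supp (alpha := alpha)) => [|j j0]; last first.
      rewrite pQ j0; under eq_bigr do rewrite Q0.
      by rewrite sumr_const mulVf.
    rewrite -prodr_const -big_split /=; apply: eq_bigr => j _.
    by rewrite pQ mulrA divff // mul1r.
  rewrite modulusM modulusX modulus_nat ler_pM ?exprn_ge0 ?modulus_ge0 //.
  by rewrite lerXn2r ?nnegrE // ler_nat -[leqRHS]card_ord max_card.
set S := (X in modulus X <= _).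
(* [N] counts the permutations of the slots; since [N >= 1], a bound for [N * S] is one for [S]. *)
pose N := #|[pred k : {ffun 'I_d -> 'I_d} | injectiveb k]|.
have N0 : (0 < N)%N.
  apply/card_gt0P; exists [ffun i => i]; rewrite inE.
  by apply/injectiveP => i j; rewrite !ffunE.
have NS : N%:R * S = \sum_(r : {ffun 'I_d -> 'I_3}) (\prod_l weight K (r l)) *
    \sum_(U : {set 'I_d}) (-1) ^+ #|~: U| *
      \sum_(alpha | low_degree d alpha)
        a alpha * \prod_i \sum_(l in U) Y alpha i (r l).
  rewrite mulr_sumr.
  transitivity (\sum_(alpha | low_degree d alpha) \sum_(r : {ffun 'I_d -> 'I_3})
      \sum_(U : {set 'I_d}) (\prod_l weight K (r l)) * ((-1) ^+ #|~: U| *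
        (a alpha * \prod_i \sum_(l in U) Y alpha i (r l)))).
    apply: eq_bigr => alpha la.
    rewrite -(EY alpha la) mulrCA -polarization_expectation mulr_sumr.
    apply: eq_bigr => r _; rewrite mulrCA mulr_sumr mulr_sumr; apply: eq_bigr => U _.
    by congr (_ * _); rewrite mulrCA.
  rewrite exchange_big; apply: eq_bigr => r _ /=.
  rewrite exchange_big mulr_sumr; apply: eq_bigr => U _ /=.
  by rewrite -mulr_sumr -mulr_sumr.
apply: (@le_trans _ _ (modulus (N%:R * S))).
  by rewrite modulusM modulus_nat ler_peMl ?modulus_ge0 // ler1n.
rewrite NS; apply: le_trans (modulus_sum _ _ _) _.
(* The constant collects [2 ^ d] subsets, [d ^ d] from [UB], and [(13 K) ^ d] from the weights. *)
apply: (@le_trans _ _ (\sum_(r : {ffun 'I_d -> 'I_3})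
    (\prod_l modulus (weight K (r l))) * (2 ^+ d * (d%:R ^+ d * B)))).
  apply: ler_sum => r _; rewrite modulusM modulus_prod ler_wpM2l //.
    by rewrite prodr_ge0 // => l _; apply: modulus_ge0.
  apply: le_trans (modulus_sum _ _ _) _.
  have -> : 2 ^+ d * (d%:R ^+ d * B) =
      \sum_(U : {set 'I_d}) (d%:R ^+ d * B).
    by rewrite sumr_const -cardsT -powersetT card_powerset cardsT card_ord -natrX mulr_natl.
  apply: ler_sum => U _.
  by rewrite modulusM modulusX modulusN modulus1 expr1n mul1r; apply: UB.
rewrite -mulr_suml -(bigA_distr_bigA (fun _ s => modulus (weight K s))) /=.
rewrite prodr_const card_ord !mulrA ler_wpM2r // -!exprMn lerXn2r ?nnegrE //.
  by rewrite !mulr_ge0 // sumr_ge0 // => s _; apply: modulus_ge0.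
apply: le_trans (ler_wpM2r _ (ler_wpM2r _ (sum_modulus_weight K0))) _ => //.
by rewrite -!natrM ler_nat; lia.
Qed.
End Extension.

(** * Cauchy estimates and the derivative of the extension *)

Section CoefficientExtraction.
Variable R : realType.

(** Cauchy's estimate; the mean over the [N]-th roots of unity replaces the contour integral and is
    exact for polynomials of size at most [N]. *)
Lemma modulus_coef_le (p : {poly R[i]}) (N k : nat) (E : R) :
  (size p <= N)%N -> (k < N)%N ->
  (forall t, modulus t = 1 -> modulus p.[t] <= E) -> modulus p`_k <= E.
Proof.
move=> sp kN pE; have N0 : (0 < N)%N by apply: leq_trans kN.
have NR0 : 0 < N%:R :> R by rewrite ltr0n.
have Np : N%:R * p`_k = \sum_(x < N) p.[omega R N ^+ x] * omega R N ^- (k * x).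
  under eq_bigr do rewrite (horner_coef_wide _ sp) mulr_suml.
  rewrite exchange_big /= (bigD1 (Ordinal kN)) //= [X in _ + X]big1 => [|i ik].
    under eq_bigr do rewrite -mulrA -exprM [(_ * k)%N]mulnC.
    by rewrite -mulr_sumr sum_omega_orthogonal // eqxx addr0 mulrC.
  under eq_bigr do rewrite -mulrA -exprM [(_ * i)%N]mulnC.
  rewrite -mulr_sumr sum_omega_orthogonal //.
  by rewrite (negbTE ik : (i == k :> nat) = false) mulr0.
rewrite -(ler_pM2l NR0) -[X in X * _](modulus_nat R) -modulusM Np.
apply: le_trans (modulus_sum _ _ _) _.
rewrite mulr_natl -[X in _ *+ X]card_ord -sumr_const; apply: ler_sum => x _.
rewrite modulusM modulusV !modulusX modulus_omega !expr1n invr1 mulr1.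
by apply: pE; rewrite modulusX modulus_omega expr1n.
Qed.

Lemma prod_linear_coef (A : comNzRingType) (I : Type) (s : seq I) (F : I -> A) :
  [/\ (\prod_(i <- s) (1 + F i *: 'X))`_0 = 1,
      (\prod_(i <- s) (1 + F i *: 'X))`_1 = \sum_(i <- s) F i &
      (size (\prod_(i <- s) (1 + F i *: 'X))%R <= (size s).+1)%N].
Proof.
elim: s => [|i s [p0 p1 sp]].
  by rewrite !big_nil size_poly1 !coef1.
rewrite !big_cons; set p := \prod_(j <- s) _ in p0 p1 sp *.
have -> : (1 + F i *: 'X) * p = p + (F i *: p) * 'X.
  by rewrite mulrDl mul1r -!scalerAl [p * _]mulrC.
split; rewrite ?coefD ?coefMX ?coefZ /= ?p0 ?p1.
- by rewrite addr0.
- by rewrite mulr1 addrC.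
rewrite (leq_trans (size_polyD _ _)) // geq_max (leq_trans sp) //=.
rewrite (leq_trans (size_polyMleq _ _)) // size_polyX addn2 /= ltnS.
exact: leq_trans (size_scale_leq _ _) sp.
Qed.

End CoefficientExtraction.

Section Derivative.
Variable R : realType.

Definition slice (K n : nat) (a : {ffun 'I_n -> 'I_K} -> R[i]) j (k : 'I_K) :
    {ffun 'I_n -> 'I_K} -> R[i] :=
  fun alpha => if alpha j == k then a alpha else 0.

(** Along [v_j(k) = z_j^k (1 + t u_(j,k))], the extension [F] is a polynomial in [t] whose linear
    coefficient is the sum of the [u_(j,k) G_(j,k)(z)]. The phases [u] make it the sum of the
    moduli, and for [|t| = 1] one has [|v| <= 2]. The point [z] need not lie in [Omega]. *)
Lemma sum_slices_bound (K n d : nat) (a : {ffun 'I_n -> 'I_K} -> R[i]) (B : R)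
    (z : 'I_n -> R[i]) :
  (0 < d)%N -> (0 < K)%N ->
  (forall z : 'I_n -> R[i], (forall j, Omega K (z j)) ->
    modulus (poly_eval d a z) <= B) ->
  (forall j, modulus (z j) = 1) ->
  \sum_j \sum_(k < K | (0 < k)%N) modulus (poly_eval d (slice a j k) z) <=
    (26 * K * d)%:R ^+ d * B.
Proof.
move=> d0 K0 fB z1.
have /choice[u uP] : forall jk : 'I_n * 'I_K, exists u : R[i], modulus u = 1 /\
    u * poly_eval d (slice a jk.1 jk.2) z =
    (modulus (poly_eval d (slice a jk.1 jk.2) z))%:C.
  by move=> jk; have [u ? ?] := phaseE (poly_eval d (slice a jk.1 jk.2) z); exists u.
pose pa (alpha : {ffun 'I_n -> 'I_K}) : {poly R[i]} :=
  \prod_(j <- enum (supp alpha)) (1 + u (j, alpha j) *: 'X).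
pose p : {poly R[i]} := \sum_(alpha | low_degree d alpha)
  (a alpha * \prod_j z j ^+ alpha j) *: pa alpha.
have sp : (size p <= d.+1)%N.
  apply: leq_trans (size_sum _ _ _) _; apply/bigmax_leqP => alpha la.
  apply: leq_trans (size_scale_leq _ _) _.
  have [_ _ s] := prod_linear_coef (enum (supp alpha)) (fun j => u (j, alpha j)).
  by apply: leq_trans s _; rewrite ltnS -cardE leq_card_supp.
have p1 : p`_1 = (\sum_j \sum_(k < K | (0 < k)%N)
    modulus (poly_eval d (slice a j k) z))%:C.
  rewrite rmorph_sum /=; under [RHS]eq_bigr do rewrite rmorph_sum /=.
  transitivity (\sum_j \sum_(k < K | (0 < k)%N) \sum_(alpha | low_degree d alpha)
      u (j, k) * (slice a j k alpha * \prod_i z i ^+ alpha i)); last first.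
    apply: eq_bigr => j _; apply: eq_bigr => k _.
    by rewrite -mulr_sumr; have [_ /= ->] := uP (j, k).
  under [RHS]eq_bigr do rewrite exchange_big /=.
  rewrite exchange_big coef_sum; apply: eq_bigr => alpha la /=.
  have [_ c _] := prod_linear_coef (enum (supp alpha)) (fun j => u (j, alpha j)).
  rewrite coefZ c big_enum /= mulr_sumr big_mkcond /=; apply: eq_bigr => j _.
  rewrite inE; case: ifPn => aj.
    rewrite (bigD1 (alpha j)) //= [X in _ = _ + X]big1 => [|k /andP[_ kj]]; last first.
      by rewrite /slice eq_sym (negbTE kj) mul0r mulr0.
    by rewrite /slice eqxx addr0 mulrC.
  rewrite big1 // => k k0; rewrite /slice; case: eqP => [jk|]; last by rewrite mul0r mulr0.
  by rewrite jk k0 in aj.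
have -> : \sum_j \sum_(k < K | (0 < k)%N) modulus (poly_eval d (slice a j k) z) =
    modulus p`_1.
  rewrite p1 modulus_real ger0_norm // sumr_ge0 // => j _; rewrite sumr_ge0 // => k _.
  exact: modulus_ge0.
apply: (modulus_coef_le sp) => // t t1.
(* Exponent 0 is left unperturbed, as [extension_bound] asks for the value 1 there. *)
pose v j (k : 'I_K) := if k == 0%N :> nat then 1 else z j ^+ k * (1 + t * u (j, k)).
have -> : p.[t] = \sum_(alpha | low_degree d alpha) a alpha * \prod_j v j (alpha j).
  rewrite /p horner_sum; apply: eq_bigr => alpha _.
  rewrite hornerZ -mulrA; congr (_ * _).
  rewrite -(prod_supp (alpha := alpha) (F := fun j => z j ^+ alpha j)); last first.
    by move=> j ->; rewrite expr0.
  rewrite -(prod_supp (alpha := alpha) (F := fun j => v j (alpha j))); last first.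
    by move=> j j0; rewrite /v j0.
  rewrite horner_prod big_enum -big_split /=; apply: eq_bigr => j; rewrite inE /v.
  by rewrite lt0n => /negbTE ->; rewrite hornerD hornerZ hornerX hornerC [t * _]mulrC.
apply: extension_bound => // [j k k0|j k]; first by rewrite /v k0.
rewrite /v; case: ifP => _; first by rewrite modulus1 ler1n.
rewrite modulusM modulusX z1 expr1n mul1r.
apply: le_trans (modulusD _ _) _; rewrite modulus1 modulusM t1 mul1r.
by have [-> _] := uP (j, k).
Qed.

End Derivative.

(** * Moments *)

Section CauchySchwarz.
Variable R : realType.

(** Lagrange's identity: the difference of the two sides is half the double sum of the
    [(f i * g j - f j * g i) ^+ 2]. *)
Lemma sum_mul_sqr_le (I : finType) (P : pred I) (f g : I -> R) :
  (\sum_(i | P i) f i * g i) ^+ 2 <=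
  (\sum_(i | P i) f i ^+ 2) * (\sum_(i | P i) g i ^+ 2).
Proof.
have : 0 <= \sum_(i | P i) \sum_(j | P j) (f i * g j - f j * g i) ^+ 2.
  by apply: sumr_ge0 => i _; apply: sumr_ge0 => j _; apply: sqr_ge0.
rewrite [X in 0 <= X](_ : _ = 2 * ((\sum_(i | P i) f i ^+ 2) *
    (\sum_(i | P i) g i ^+ 2) - (\sum_(i | P i) f i * g i) ^+ 2)); first by lra.
have dist (u v : I -> R) : \sum_(i | P i) \sum_(j | P j) u i * v j =
    (\sum_(i | P i) u i) * (\sum_(j | P j) v j).
  by rewrite mulr_suml; apply: eq_bigr => i _; rewrite mulr_sumr.
transitivity (\sum_(i | P i) \sum_(j | P j)
    (f i ^+ 2 * g j ^+ 2 + g i ^+ 2 * f j ^+ 2 - (2 * (f i * g i)) * (f j * g j))).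
  by apply: eq_bigr => i _; apply: eq_bigr => j _; ring.
under eq_bigr do rewrite sumrB big_split /=.
rewrite sumrB big_split /= !dist -mulr_sumr; ring.
Qed.

Lemma modulus_sum_sqr_le (I : finType) (P : pred I) (F : I -> R[i]) :
  modulus (\sum_(i | P i) F i) ^+ 2 <=
  #|P|%:R * \sum_(i | P i) modulus (F i) ^+ 2.
Proof.
apply: (@le_trans _ _ ((\sum_(i | P i) 1 * modulus (F i)) ^+ 2)).
  rewrite (eq_bigr (fun i => modulus (F i))) => [|i _]; last by rewrite mul1r.
  by rewrite lerXn2r ?nnegrE ?modulus_ge0 ?sumr_ge0 ?modulus_sum // => i _;
    apply: modulus_ge0.
apply: le_trans (sum_mul_sqr_le _ _ _) _.
by rewrite (eq_bigr (fun=> 1)) ?sumr_const // => i _; rewrite expr1n.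
Qed.

End CauchySchwarz.

Section Moments.
Variables (R : realType) (n : nat).

Definition root_point (N : nat) (x : {ffun 'I_n -> 'I_N}) : 'I_n -> R[i] :=
  fun j => omega R N ^+ x j.

(** Distinct exponent vectors below [N] give orthogonal characters. The index type is abstract so as
    to cover both the monomials of [f] and those of its square. *)
Lemma parseval (N : nat) (T : finType) (e : T -> {ffun 'I_n -> 'I_N})
    (c : T -> R[i]) : (0 < N)%N -> injective e ->
  \sum_(x : {ffun 'I_n -> 'I_N})
    modulus (\sum_t c t * \prod_j root_point x j ^+ e t j) ^+ 2 =
  N%:R ^+ n * \sum_t modulus (c t) ^+ 2.
Proof.
move=> N0 e_inj; apply: complexI; rewrite rmorph_sum /=.
pose ph (t : T) (x : {ffun 'I_n -> 'I_N}) := \prod_j root_point x j ^+ e t j.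
have orth t t' : \sum_(x : {ffun 'I_n -> 'I_N}) ph t x * ((ph t' x)^*)%C =
    if t == t' then N%:R ^+ n else 0.
  transitivity (\sum_(x : {ffun 'I_n -> 'I_N})
      \prod_j (omega R N ^+ (e t j * x j) * omega R N ^- (e t' j * x j))).
    apply: eq_bigr => x _; rewrite rmorph_prod -big_split /=.
    apply: eq_bigr => j _; rewrite /root_point -!exprM conj_omegaX.
    by rewrite ![(x j * _)%N]mulnC.
  rewrite -(bigA_distr_bigA (fun j (y : 'I_N) =>
    omega R N ^+ (e t j * y) * omega R N ^- (e t' j * y))) /=.
  under eq_bigr do rewrite sum_omega_orthogonal //.
  case: eqP => [->|tt'].
    by under eq_bigr do rewrite eqxx; rewrite prodr_const card_ord.
  have /eqP/ffunP/existsNP[j /eqP ej] : e t != e t'.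
    by apply/eqP => /e_inj.
  by rewrite (bigD1 j) //= ifN ?mul0r.
transitivity (\sum_t \sum_t' c t * ((c t')^*)%C *
    \sum_(x : {ffun 'I_n -> 'I_N}) ph t x * ((ph t' x)^*)%C).
  transitivity (\sum_(x : {ffun 'I_n -> 'I_N}) \sum_t \sum_t'
      c t * ((c t')^*)%C * (ph t x * ((ph t' x)^*)%C)).
    apply: eq_bigr => x _; rewrite modulus_sqr rmorph_sum /= mulr_suml.
    apply: eq_bigr => t _; rewrite mulr_sumr; apply: eq_bigr => t' _.
    by rewrite rmorphM /= mulrACA.
  rewrite exchange_big; apply: eq_bigr => t _ /=.
  by rewrite exchange_big; apply: eq_bigr => t' _ /=; rewrite mulr_sumr.
rewrite rmorphM rmorphXn /= rmorph_nat rmorph_sum mulr_sumr /=.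
apply: eq_bigr => t _; rewrite (bigD1 t) //= [X in _ + X]big1 => [|t' tt'].
  by rewrite addr0 orth eqxx -modulus_sqr mulrC.
by rewrite orth eq_sym (negbTE tt') mulr0.
Qed.

Lemma poly_eval_second_moment (K N d : nat) (a : {ffun 'I_n -> 'I_K} -> R[i]) :
  (0 < N)%N -> (K <= N)%N ->
  \sum_(x : {ffun 'I_n -> 'I_N}) modulus (poly_eval d a (root_point x)) ^+ 2 =
  N%:R ^+ n * \sum_(alpha | low_degree d alpha) modulus (a alpha) ^+ 2.
Proof.
move=> N0 KN.
pose e (alpha : {ffun 'I_n -> 'I_K}) : {ffun 'I_n -> 'I_N} :=
  [ffun j => widen_ord KN (alpha j)].
have e_inj : injective e.
  move=> al be /ffunP h; apply/ffunP => j; apply: val_inj.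
  by have := congr1 val (h j); rewrite !ffunE.
have P := parseval (fun alpha => if low_degree d alpha then a alpha else 0) N0 e_inj.
transitivity (N%:R ^+ n * \sum_alpha
    modulus (if low_degree d alpha then a alpha else 0) ^+ 2); last first.
  rewrite [in RHS]big_mkcond /=; congr (_ * _); apply: eq_bigr => al _.
  by case: ifP => // _; rewrite modulus0 expr0n.
rewrite -P; apply: eq_bigr => x _; congr (modulus _ ^+ 2).
rewrite /poly_eval big_mkcond; apply: eq_bigr => al _ /=.
case: ifP => _; rewrite ?mul0r //; congr (_ * _).
by apply: eq_bigr => j _; rewrite ffunE.
Qed.

(* On the roots of unity of order [2 K] the exponents of a product of two
   monomials do not wrap around. *)
Lemma leq_add_ord (K : nat) (i j : 'I_K) : (i + j < 2 * K)%N.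
Proof. by have := ltn_ord i; have := ltn_ord j; lia. Qed.

Definition midx_add (K : nat) (p : {ffun 'I_n -> 'I_K} * {ffun 'I_n -> 'I_K}) :
    {ffun 'I_n -> 'I_(2 * K)} :=
  [ffun j => Ordinal (leq_add_ord (p.1 j) (p.2 j))].

(** A pair is determined by its first member, which lies coordinatewise below [gam]. This leaves at
    most [\prod_j (gam j + 1) <= 2 ^ (\sum_j gam j)] choices, and the sum is at most [2 d] as soon
    as one pair exists. *)
Lemma card_midx_add (K d : nat) (gam : {ffun 'I_n -> 'I_(2 * K)}) :
  (#|[pred p : {ffun 'I_n -> 'I_K} * {ffun 'I_n -> 'I_K} |
     [&& low_degree d p.1, low_degree d p.2 & midx_add p == gam]]| <= 4 ^ d)%N.
Proof.
set P := [pred p | _].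
case: (pickP P) => [p0 /and3P[l1 l2 /eqP gE]|P0]; last by rewrite eq_card0.
have gd : (\sum_(j < n) gam j <= 2 * d)%N.
  rewrite -gE (eq_bigr (fun j => p0.1 j + p0.2 j)%N) => [|j _]; last by rewrite ffunE.
  by rewrite big_split mul2n -addnn leq_add.
pose Q (j : 'I_n) := [pred i : 'I_K | (i <= gam j)%N].
have cardQ j : (#|Q j| <= 2 ^ gam j)%N.
  apply: leq_trans (ltn_expl (gam j) (isT : 1 < 2)%N).
  rewrite cardE -(size_map val) -[X in (_ <= X)%N](size_iota 0).
  apply: uniq_leq_size; first by rewrite map_inj_uniq ?enum_uniq //; apply: val_inj.
  by move=> i /mapP[k]; rewrite mem_enum inE mem_iota => h ->; rewrite add0n ltnS.
have : (#|family Q| <= 4 ^ d)%N.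
  rewrite -sum1_card.
  have -> : (\sum_(f in family Q) 1 = \prod_j \sum_(i | Q j i) 1)%N.
    rewrite bigA_distr_big_dep; apply: eq_bigr => f _.
    by rewrite big1.
  apply: (@leq_trans (\prod_(j < n) 2 ^ gam j)%N).
    by apply: leq_prod => j _; rewrite sum1_card; apply: cardQ.
  by rewrite -expn_sum (_ : 4 ^ d = 2 ^ (2 * d))%N ?leq_exp2l // expnM.
apply: leq_trans; rewrite -(card_in_image (f := fst)) => [|p q].
  apply/subset_leq_card/fintype.subsetP => al; case/fintype.imageP=> p /and3P[_ _ /eqP gp] ->.
  by apply/familyP => j; rewrite inE -gp ffunE /= leq_addr.
move=> /and3P[_ _ /eqP gp] /and3P[_ _ /eqP gq] pq.
case: p q gp gq pq => [p1 p2] [q1 q2] /= gp gq pq; subst q1; congr (_, _).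
apply/ffunP => j; apply: val_inj; apply: (@addnI (p1 j)).
by move: gp; rewrite -gq => /ffunP/(_ j)/(congr1 val); rewrite !ffunE.
Qed.

(** Parseval for the square of [f]: each of its coefficients is a sum over at most [4 ^ d] pairs,
    which is the loss in Cauchy--Schwarz. *)
Lemma poly_eval_fourth_moment (K d : nat) (a : {ffun 'I_n -> 'I_K} -> R[i]) :
  (0 < K)%N ->
  \sum_(x : {ffun 'I_n -> 'I_(2 * K)})
    modulus (poly_eval d a (root_point x)) ^+ 4 <=
  (2 * K)%:R ^+ n * (4 ^+ d *
    (\sum_(alpha | low_degree d alpha) modulus (a alpha) ^+ 2) ^+ 2).
Proof.
move=> K0.
pose low2 (p : {ffun 'I_n -> 'I_K} * {ffun 'I_n -> 'I_K}) :=
  low_degree d p.1 && low_degree d p.2.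
pose c gam := \sum_(p | low2 p && (midx_add p == gam)) a p.1 * a p.2.
have sqE (x : {ffun 'I_n -> 'I_(2 * K)}) : poly_eval d a (root_point x) ^+ 2 =
    \sum_gam c gam * \prod_j root_point x j ^+ gam j.
  transitivity (\sum_(p | low2 p) (a p.1 * a p.2) *
      \prod_j root_point x j ^+ midx_add p j).
    rewrite expr2 /poly_eval mulr_suml.
    under eq_bigr do rewrite mulr_sumr.
    rewrite pair_big /=; apply: eq_bigr => p _.
    rewrite mulrACA -big_split /=; congr (_ * _); apply: eq_bigr => j _.
    by rewrite ffunE /= exprD.
  rewrite (partition_big (@midx_add K) predT) //=; apply: eq_bigr => gam _.
  by rewrite /c mulr_suml; apply: eq_bigr => p /andP[_ /eqP ->].
have -> : \sum_(x : {ffun 'I_n -> 'I_(2 * K)})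
    modulus (poly_eval d a (root_point x)) ^+ 4 =
    (2 * K)%:R ^+ n * \sum_gam modulus (c gam) ^+ 2.
  rewrite -(parseval c (e := id)) ?muln_gt0 //; apply: eq_bigr => x _.
  by rewrite -sqE modulusX -exprM.
rewrite ler_wpM2l ?exprn_ge0 //.
rewrite expr2 mulr_suml mulr_sumr.
have -> : \sum_(al | low_degree d al) 4 ^+ d * (modulus (a al) ^+ 2 *
    (\sum_(be | low_degree d be) modulus (a be) ^+ 2)) =
  \sum_gam 4 ^+ d * \sum_(p | low2 p && (midx_add p == gam))
    modulus (a p.1 * a p.2) ^+ 2.
  rewrite -!mulr_sumr -(partition_big (@midx_add K) predT) //=; congr (_ * _).
  under eq_bigr do rewrite mulr_sumr.
  by rewrite pair_big /=; apply: eq_bigr => p _; rewrite modulusM exprMn.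
apply: ler_sum => gam _; apply: le_trans (modulus_sum_sqr_le _ _) _.
rewrite ler_wpM2r ?sumr_ge0 // => [p _|]; first exact: sqr_ge0.
rewrite -natrX ler_nat; apply: leq_trans (card_midx_add d gam).
by rewrite leq_eqVlt; apply/orP; left; apply/eqP/eq_card => p; rewrite -[LHS]/(low2 p && (midx_add p == gam)) /low2 -andbA.
Qed.

(* Gives a lower bound for the first moment in terms of the second and fourth. *)
Lemma quartic_tangent (l X : R) : 0 <= l -> 0 <= X ->
  4 * l ^+ 2 * X ^+ 2 - X ^+ 4 <= 4 * l ^+ 3 * X.
Proof.
move=> l0 X0; rewrite -subr_ge0.
have -> : 4 * l ^+ 3 * X - (4 * l ^+ 2 * X ^+ 2 - X ^+ 4) =
  X * (4 * l ^+ 2 * (l - X) + X ^+ 3) by ring.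
apply: mulr_ge0 => //; have [Xl|lX] := lerP X l.
  by rewrite addr_ge0 ?exprn_ge0 // mulr_ge0 ?mulr_ge0 ?exprn_ge0 ?subr_ge0.
(* Expansion in powers of [X - l], completing the square. *)
have -> : 4 * l ^+ 2 * (l - X) + X ^+ 3 =
  l * ((l - (X - l) / 2) ^+ 2 + (11 / 4) * (X - l) ^+ 2) + (X - l) ^+ 3 by field.
have Xl0 : 0 <= X - l by lra.
by rewrite addr_ge0 ?exprn_ge0 // mulr_ge0 // addr_ge0 ?sqr_ge0 // mulr_ge0 ?sqr_ge0.
Qed.

Lemma l2_le_average (K d : nat) (a : {ffun 'I_n -> 'I_K} -> R[i]) :
  (0 < K)%N ->
  (2 * K)%:R ^+ n *
    Num.sqrt (\sum_(alpha | low_degree d alpha) modulus (a alpha) ^+ 2) <=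
  2 ^+ d.+1 *
    \sum_(x : {ffun 'I_n -> 'I_(2 * K)}) modulus (poly_eval d a (root_point x)).
Proof.
move=> K0; set S := \sum_(alpha | _) _; set s := Num.sqrt S.
set X := \sum_x _; set W := (2 * K)%:R ^+ n.
have X0 : 0 <= X by apply: sumr_ge0 => x _; apply: modulus_ge0.
have S0 : 0 <= S by apply: sumr_ge0 => al _; apply: sqr_ge0.
have sS : s ^+ 2 = S by rewrite sqr_sqrtr.
have [s0|s_gt0] := lerP s 0.
  rewrite (_ : s = 0) ?mulr0 ?mulr_ge0 ?exprn_ge0 //.
  by apply/eqP; rewrite eq_le s0 sqrtr_ge0.
have N0 : (0 < 2 * K)%N by rewrite muln_gt0.
have KN : (K <= 2 * K)%N by rewrite leq_pmull.
have m2 := poly_eval_second_moment d a N0 KN.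
have m4 := poly_eval_fourth_moment d a K0.
rewrite -/S -/W in m2 m4.
(* With this [l], [4 ^+ d * S = l ^+ 2], so the fourth moment is at most a quarter of the
   second-moment term when [quartic_tangent] is summed over the roots. *)
pose l := 2 ^+ d * s.
have l0 : 0 < l by rewrite mulr_gt0 ?exprn_gt0.
have l2 : l ^+ 2 = 4 ^+ d * S.
  by rewrite exprMn sS -exprM mulnC exprM (_ : 2 ^+ 2 = 4 :> R) //; ring.
have : \sum_(x : {ffun 'I_n -> 'I_(2 * K)})
     (4 * l ^+ 2 * modulus (poly_eval d a (root_point x)) ^+ 2 -
       modulus (poly_eval d a (root_point x)) ^+ 4) <= 4 * l ^+ 3 * X.
  rewrite mulr_sumr; apply: ler_sum => x _.
  by apply: quartic_tangent; [exact: ltW|exact: modulus_ge0].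
rewrite sumrB -mulr_sumr m2 => h.
have {h m4} : 3 * l ^+ 2 * (W * S) <= 4 * l ^+ 3 * X.
  apply: le_trans h; move: m4; rewrite l2; move: (4 ^+ d) (\sum_x _) => q M m4.
  by rewrite -subr_ge0; rewrite -subr_ge0 in m4; apply: le_trans m4 _; lra.
rewrite -sS [l ^+ 3]exprS.
have -> : 3 * l ^+ 2 * (W * s ^+ 2) = (l ^+ 2 * s) * (3 * (W * s)) by ring.
have -> : 4 * (l * l ^+ 2) * X = (l ^+ 2 * s) * (2 * (2 ^+ d.+1 * X)).
  by rewrite /l [2 ^+ d.+1]exprS; move: (2 ^+ d) => q; ring.
have W0 : 0 <= W by rewrite exprn_ge0.
have Ws : 0 <= W * s by rewrite mulr_ge0 // ltW.
rewrite ler_pM2l ?mulr_gt0 ?exprn_gt0 //; lra.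
Qed.

End Moments.

(** * Blei's inequality and the cyclic Bohnenblust--Hille inequality *)

Section Blei.
Variable R : realType.

Lemma powR_bh (d : nat) (b : R) : 0 <= b ->
  (b `^ bh_exponent R d) ^+ d.+1 = b ^+ (2 * d).
Proof.
move=> b0; rewrite -powR_mulrn ?powR_ge0 // -powRrM /bh_exponent.
by rewrite divfK ?pnatr_eq0 // powR_mulrn.
Qed.

Lemma expR1_le4 : expR 1 <= 4 :> R.
Proof.
have h : 1 / 2 <= expR (- (1 / 2)) :> R.
  by apply: le_trans (expR_ge1Dx _); lra.
have e0 : 0 < expR (1 / 2) :> R by apply: expR_gt0.
have ef : expR (1 / 2) * expR (- (1 / 2)) = 1 :> R by rewrite -expRD subrr expR0.
have e2 : expR (1 / 2) <= 2 :> R by nra.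
have -> : 1 = 1 / 2 + 1 / 2 :> R by lra.
rewrite expRD; nra.
Qed.

Lemma prod_1D_le4 (I : finType) (F : I -> R) :
  (forall i, 0 <= F i) -> \sum_i F i <= 1 -> \prod_i (1 + F i) <= 4.
Proof.
move=> F0 F1; apply: le_trans expR1_le4.
apply: (@le_trans _ _ (expR (\sum_i F i))); last by rewrite ler_expR.
rewrite expR_sum; apply: ler_prod => i _.
by rewrite addr_ge0 //= expR_ge1Dx.
Qed.

Variables (K n d : nat) (b : {ffun 'I_n -> 'I_K} -> R).
Hypotheses (d0 : (0 < d)%N) (b0 : forall al, 0 <= b al).

Definition slice_norm (j : 'I_n) (k : 'I_K) : R :=
  Num.sqrt (\sum_(al | low_degree d al && (al j == k)) b al ^+ 2).

(* AM-GM for [d + 1] numbers: one per slot, [b^2 / slice_norm] or [b^2], and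
   the product of the slice norms. *)
Lemma blei_pointwise al : low_degree d al ->
  b al `^ bh_exponent R d *+ d.+1 <=
  \sum_(j in supp al) b al ^+ 2 / slice_norm j (al j) +
  d%:R * b al ^+ 2 + \prod_(j in supp al) slice_norm j (al j).
Proof.
move=> la; have sd := leq_card_supp la.
have N0 j : 0 <= slice_norm j (al j) by apply: sqrtr_ge0.
(* A zero coefficient is set apart because the slice norms, which are divided by, are then possibly
   zero. *)
have [ba|ba] := eqVneq (b al) 0.
  rewrite ba powR0; last by rewrite /bh_exponent mulf_neq0 ?invr_eq0 ?pnatr_eq0 ?muln_eq0 //= -lt0n.
  rewrite mul0rn !addr_ge0 ?prodr_ge0 ?mulr_ge0 ?sqr_ge0 ?sumr_ge0 // => j _.
  by rewrite mulr_ge0 ?sqr_ge0 ?invr_ge0.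
have {}ba : 0 < b al by rewrite lt_neqAle eq_sym ba b0.
have Npos j : 0 < slice_norm j (al j).
  rewrite sqrtr_gt0 (bigD1 al) /= ?la ?eqxx // ltr_pwDl ?exprn_gt0 //.
  by apply: sumr_ge0 => al' _; apply: sqr_ge0.
pose F o := if o is Some j then b al ^+ 2 / slice_norm j (al j) else b al ^+ 2.
have F0 o : 0 <= F o.
  by case: o => [j|]; rewrite /F ?mulr_ge0 ?sqr_ge0 ?invr_ge0.
pose P := \prod_(j in supp al) slice_norm j (al j).
have P0 : 0 <= P by apply: prodr_ge0.
pose E (i : 'I_d.+1) := if (i < d)%N then F (slot d al i) else P.
have E0 i : 0 <= E i by rewrite /E; case: ifP.
have sumE : \sum_i E i = \sum_(j in supp al) b al ^+ 2 / slice_norm j (al j) +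
    (d - #|supp al|)%:R * b al ^+ 2 + P.
  rewrite big_ord_recr /= /E ltnn; congr (_ + _).
  under eq_bigr do rewrite /= ltn_ord.
  by rewrite (big_slot _ F) // iter_addr_0 /= mulr_natl.
(* The slice norms in the slots cancel against those in [P]; the [d + 1]-st root of what is left is
   the wanted power of [b]. *)
have prodE : \prod_i E i = b al ^+ (2 * d).
  rewrite big_ord_recr /= /E ltnn.
  under eq_bigr do rewrite /= ltn_ord.
  rewrite (big_slot _ F) // iter_mulr_1 /= mulrAC -big_split /=.
  under eq_bigr do rewrite divfK ?gt_eqF //.
  by rewrite prodr_const -exprD subnKC // -exprM.
have := leif_AGM (A := predT) (E := E) (fun i _ => E0 i).
rewrite card_ord => -[agm _]; move: agm; rewrite prodE -powR_bh //.
rewrite ler_pXn2r ?nnegrE ?powR_ge0 ?divr_ge0 ?sumr_ge0 //.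
rewrite ler_pdivlMr ?ltr0n // mulr_natr => /le_trans; apply.
rewrite sumE lerD2r lerD2l ler_wpM2r ?sqr_ge0 // ler_nat; exact: leq_subr.
Qed.

(* Blei's inequality for coefficients indexed by sets rather than by
   [d]-tuples: no decoupling is needed. *)
Lemma blei :
  \sum_j \sum_(k < K | (0 < k)%N) slice_norm j k <= 1 ->
  \sum_(al | low_degree d al) b al ^+ 2 <= 1 ->
  \sum_(al | low_degree d al) b al `^ bh_exponent R d <= 5.
Proof.
move=> N1 b1.
have N0 j k : 0 <= slice_norm j k by apply: sqrtr_ge0.
have D0 : 0 < d.+1%:R :> R by rewrite ltr0n.
rewrite -(ler_pM2r D0) mulr_natr -sumrMnl.
apply: le_trans (ler_sum _ (fun al la => blei_pointwise la)) _.
rewrite !big_split /= -mulr_sumr.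
have -> : \sum_(al | low_degree d al)
    \sum_(j in supp al) b al ^+ 2 / slice_norm j (al j) =
    \sum_j \sum_(k < K | (0 < k)%N) slice_norm j k.
  under eq_bigr do rewrite big_mkcond /=.
  rewrite exchange_big; apply: eq_bigr => j _ /=.
  rewrite -big_mkcondr /= (partition_big (fun al : {ffun 'I_n -> 'I_K} => al j)
    (fun k : 'I_K => 0 < k)%N) => [|al /andP[_]]; last by rewrite inE.
  apply: eq_bigr => k k0.
  transitivity (\sum_(al | low_degree d al && (al j == k))
      b al ^+ 2 / slice_norm j k).
    apply: eq_big => [al|al /andP[_ /eqP ->] //].
    rewrite inE -andbA; congr (_ && _).
    by case: eqP => [->|]; rewrite ?andbF ?k0.
  rewrite -mulr_suml -[X in X / _]sqr_sqrtr ?sumr_ge0 // => [|al _]; last exact: sqr_ge0.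
  rewrite -/(slice_norm j k) expr2.
  (* For a vanishing norm the quotient is 0 by the convention on division. *)
  by have [->|nz] := eqVneq (slice_norm j k) 0; rewrite ?mul0r // mulfK.
have P4 : \sum_(al | low_degree d al) \prod_(j in supp al) slice_norm j (al j) <= 4.
  (* With weight 1 at exponent 0 the sum can be enlarged to all multi-indices and factored into the
     [1 + \sum_k slice_norm j k]. *)
  pose r j (k : 'I_K) := if (0 < k)%N then slice_norm j k else 1.
  have r0 j k : 0 <= r j k by rewrite /r; case: ifP.
  apply: (@le_trans _ _ (\sum_(al : {ffun 'I_n -> 'I_K}) \prod_j r j (al j))).
    rewrite [leRHS](bigID (low_degree d)) /= ler_wpDr //.
      by apply: sumr_ge0 => al _; apply: prodr_ge0.
    apply: ler_sum => al _.
    rewrite -(prod_supp (alpha := al)) => [|j j0]; last by rewrite /r j0.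
    by rewrite le_eqVlt; apply/orP; left; apply/eqP; apply: eq_bigr => j;
      rewrite inE /r => ->.
  rewrite -bigA_distr_bigA /=.
  apply: le_trans (prod_1D_le4 _ N1); last first.
    by move=> j; apply: sumr_ge0.
  apply: ler_prod => j _; rewrite sumr_ge0 //=.
  rewrite (bigID (fun k : 'I_K => (0 < k)%N)) /= addrC lerD //; last first.
    by apply: ler_sum => k k0; rewrite /r k0.
  rewrite (eq_bigr (fun=> 1)) => [|k /negbTE k0]; last by rewrite /r k0.
  rewrite sumr_const lern1; apply/card_le1_eqP => k k'.
  rewrite -!topredE /= -!eqn0Ngt => /eqP k0 /eqP k'0.
  by apply: val_inj; rewrite /= k0 k'0.
(* The three parts add up to at most [1 + d + 4], which is at most [5 (d + 1)]. *)
rewrite -[d.+1]addn1 natrD.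
have dR : 1 <= d%:R :> R by rewrite ler1n.
have := ler_wpM2l (ler0n R d) b1; lra.
Qed.

End Blei.

Section CyclicBH.
Variable R : realType.

Lemma modulus_Omega (K : nat) (z : R[i]) : Omega K z -> modulus z = 1.
Proof. by case=> j _ <-; rewrite modulusX modulus_omega expr1n. Qed.

Lemma modulus_poly_eval_le (K n d : nat) (a : {ffun 'I_n -> 'I_K} -> R[i])
    (z : 'I_n -> R[i]) : (forall j, Omega K (z j)) ->
  modulus (poly_eval d a z) <= Omega_supnorm d a.
Proof.
move=> Oz; apply: ub_le_sup; last by exists z.
(* [sup] dominates its set only when the set is bounded above; the sum of the moduli of the
   coefficients is such a bound. *)
exists (\sum_(alpha | low_degree d alpha) modulus (a alpha)) => _ [y Oy <-].
apply: le_trans (modulus_sum _ _ _) _; apply: ler_sum => alpha _.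
rewrite modulusM modulus_prod big1 ?mulr1 // => j _.
by rewrite modulusX (modulus_Omega (Oy j)) expr1n.
Qed.

Lemma Omega_supnorm_ge0 (K n d : nat) (a : {ffun 'I_n -> 'I_K} -> R[i]) :
  (0 < K)%N -> 0 <= Omega_supnorm d a.
Proof.
move=> K0; apply: le_trans (modulus_ge0 _) (@modulus_poly_eval_le _ _ d a (fun=> 1) _).
by move=> j; exists 0%N; rewrite //= expr0.
Qed.

Lemma bh_exponent_ge1 d : (0 < d)%N -> 1 <= bh_exponent R d.
Proof. by move=> d0; rewrite /bh_exponent ler_pdivlMr ?ltr0n // mul1r ler_nat; lia. Qed.

(** Undoes a normalization by [T], the degenerate case [T = 0] included; [c <= c ^ p] spares the
    root of the constant. *)
Lemma lpnorm_le_scale (I : finType) (P : pred I) (a : I -> R[i]) (p T c : R) :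
  1 <= p -> 0 <= T -> 1 <= c ->
  (forall i, P i -> T = 0 -> a i = 0) ->
  \sum_(i | P i) (modulus (a i) / T) `^ p <= c ->
  lpnorm p P a <= c * T.
Proof.
move=> p1 T0 c1 aT0 sum_c.
have p0 : p != 0 by rewrite gt_eqF // (lt_le_trans _ p1).
have c0 : 0 <= c by apply: le_trans c1.
have cT : 0 <= c * T by rewrite mulr_ge0.
rewrite /lpnorm -[leRHS](powRr1 cT) -(divff p0) powRrM.
apply: ge0_ler_powR; rewrite ?invr_ge0 ?nnegrE ?powR_ge0 ?(le_trans ler01 p1) //.
  by apply: sumr_ge0 => i _; apply: powR_ge0.
rewrite powRM //; apply: (@le_trans _ _ (c * T `^ p)).
  rewrite (eq_bigr (fun i => (modulus (a i) / T) `^ p * T `^ p)) => [|i Pi].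
    by rewrite -mulr_suml ler_wpM2r ?powR_ge0.
  rewrite -powRM ?mulr_ge0 ?invr_ge0 ?modulus_ge0 //.
  have [T00|T00] := eqVneq T 0; last by rewrite divfK.
  by rewrite aT0 // modulus0 mul0r mul0r.
rewrite ler_wpM2r ?powR_ge0 //.
by rewrite -[leLHS](powRr1 c0) ler_powR.
Qed.

Theorem cyclic_bh (K d : nat) : (0 < K)%N -> (0 < d)%N ->
  cyclic_bh_bound K d (5 * 2 ^+ d.+1 * (26 * K * d)%:R ^+ d : R).
Proof.
move=> K0 d0 n a n0.
set B := Omega_supnorm d a; set M := (26 * K * d)%:R ^+ d.
have B0 : 0 <= B by apply: Omega_supnorm_ge0.
have M0 : 0 <= M :> R by apply: exprn_ge0.
have fB (z : 'I_n -> R[i]) : (forall j, Omega K (z j)) -> modulus (poly_eval d a z) <= B.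
  exact: modulus_poly_eval_le.
have N0 : (0 < 2 * K)%N by rewrite muln_gt0.
have W0 : 0 < (2 * K)%:R ^+ n :> R by rewrite exprn_gt0 // ltr0n.
have root1 (x : {ffun 'I_n -> 'I_(2 * K)}) j : modulus (root_point R x j) = 1.
  by rewrite modulusX modulus_omega expr1n.
have sum_const (c : R) : \sum_(x : {ffun 'I_n -> 'I_(2 * K)}) c = (2 * K)%:R ^+ n * c.
  by rewrite sumr_const card_ffun !card_ord -natrX mulr_natl.
(* A common bound for the 2-norm of the coefficients and the sum of the slice norms: dividing by [T]
   yields both hypotheses of [blei]. *)
pose T := 2 ^+ d.+1 * (M * B).
have T0 : 0 <= T by rewrite mulr_ge0 ?exprn_ge0 // mulr_ge0.
have MBT : M * B <= T by rewrite ler_peMl ?mulr_ge0 // exprn_ege1 // ler1n.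
(* The [2 K]-th roots of unity may lie outside [Omega], where [f] is controlled only through
   [extension_bound]. *)
have sum2 : \sum_(al | low_degree d al) modulus (a al) ^+ 2 <= T ^+ 2.
  rewrite -(ler_pM2l W0) -(poly_eval_second_moment d a N0) ?leq_pmull //.
  rewrite -sum_const; apply: ler_sum => x _.
  rewrite lerXn2r ?nnegrE ?modulus_ge0 //; apply: le_trans MBT.
  apply: (extension_bound (v := fun j k => root_point R x j ^+ k)) => // [j k ->|j k].
    by rewrite expr0.
  by rewrite modulusX root1 expr1n ler1n.
have sumN : \sum_j \sum_(k < K | (0 < k)%N)
    slice_norm d (fun al => modulus (a al)) j k <= T.
  rewrite -(ler_pM2l W0) mulr_sumr.
  apply: (@le_trans _ _ (2 ^+ d.+1 * \sum_(x : {ffun 'I_n -> 'I_(2 * K)})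
      \sum_j \sum_(k < K | (0 < k)%N) modulus (poly_eval d (slice a j k) (root_point R x)))).
    rewrite exchange_big mulr_sumr /=; apply: ler_sum => j _.
    rewrite exchange_big !mulr_sumr /=; apply: ler_sum => k _.
    apply: le_trans (l2_le_average d (slice a j k) K0).
    rewrite ler_wpM2l ?(ltW W0) // /slice_norm big_mkcondr /=.
    rewrite le_eqVlt; apply/orP; left; apply/eqP; congr Num.sqrt.
    by apply: eq_bigr => al _; rewrite /slice; case: ifP => // _; rewrite modulus0 expr0n.
  rewrite /T mulrCA ler_wpM2l ?exprn_ge0 // -sum_const; apply: ler_sum => x _.
  exact: sum_slices_bound.
rewrite -!mulrA -/T; apply: lpnorm_le_scale => //; first exact: bh_exponent_ge1.
- by rewrite ler1n.
- move=> al la Te; apply: modulus_eq0; apply/eqP.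
  rewrite -sqrf_eq0 eq_le sqr_ge0 andbT.
  move: sum2; rewrite Te expr0n /=; apply: le_trans.
  by rewrite (bigD1 al) //= lerDl sumr_ge0 // => be _; apply: sqr_ge0.
have [Te|Tn0] := eqVneq T 0.
  rewrite big1 // => al _; rewrite Te invr0 mulr0 powR0 //.
  by rewrite gt_eqF // (lt_le_trans _ (bh_exponent_ge1 d0)).
have Tgt : 0 < T by rewrite lt_neqAle eq_sym Tn0.
apply: (blei d0) => [al||].
- by rewrite divr_ge0 ?modulus_ge0.
- apply: (@le_trans _ _ (T^-1 * \sum_j \sum_(k < K | (0 < k)%N)
      slice_norm d (fun al => modulus (a al)) j k)); last first.
    by rewrite ler_pdivrMl ?mulr1.
  rewrite mulr_sumr; apply: ler_sum => j _; rewrite mulr_sumr; apply: ler_sum => k _.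
  rewrite /slice_norm; under eq_bigr do rewrite exprMn.
  rewrite -mulr_suml sqrtrM ?sumr_ge0 // => [|al _]; last exact: sqr_ge0.
  by rewrite sqrtr_sqr ger0_norm ?invr_ge0 // mulrC.
under eq_bigr do rewrite exprMn.
by rewrite -mulr_suml exprVn ler_pdivrMr ?mul1r // exprn_gt0.
Qed.

End CyclicBH.

(** * Reduction of the Heisenberg--Weyl case to the cyclic case *)

Section OperatorNorm.
Variable R : realType.

Definition qform (N : nat) (A : 'M[R[i]]_N) (u : 'cV[R[i]]_N) : R[i] :=
  \sum_s \sum_t ((u s 0)^*)%C * A s t * u t 0.

Lemma l2norm_ge0 N (v : 'cV[R[i]]_N) : 0 <= l2norm v.
Proof. exact: sqrtr_ge0. Qed.

Lemma l2norm_sqr N (v : 'cV[R[i]]_N) : l2norm v ^+ 2 = \sum_i modulus (v i 0) ^+ 2.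
Proof. by rewrite sqr_sqrtr // sumr_ge0 // => i _; apply: sqr_ge0. Qed.

Lemma l2norm_mulmx_le N (A : 'M[R[i]]_N) v : l2norm v <= 1 ->
  l2norm (A *m v) <= opnorm A.
Proof.
move=> v1; apply: ub_le_sup; last by exists v.
(* The Frobenius norm shows that the set defining [opnorm] is bounded above. *)
exists (Num.sqrt (\sum_s \sum_t modulus (A s t) ^+ 2)) => _ [w /= w1 <-].
apply: ler_wsqrtr; apply: ler_sum => s _; rewrite mxE.
apply: (@le_trans _ _ ((\sum_t modulus (A s t) * modulus (w t 0)) ^+ 2)).
  rewrite lerXn2r ?nnegrE ?modulus_ge0 //.
    by apply: sumr_ge0 => t _; rewrite mulr_ge0 ?modulus_ge0.
  apply: le_trans (modulus_sum _ _ _) _.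
  by apply: ler_sum => t _; rewrite modulusM.
apply: le_trans (sum_mul_sqr_le _ _ _) _.
rewrite -l2norm_sqr ler_piMr ?exprn_ile1 ?l2norm_ge0 //.
by apply: sumr_ge0 => t _; apply: sqr_ge0.
Qed.

Lemma opnorm_ge0 N (A : 'M[R[i]]_N) : 0 <= opnorm A.
Proof.
apply: le_trans (l2norm_ge0 (A *m 0)) (l2norm_mulmx_le A (v := 0) _).
rewrite /l2norm big1 ?sqrtr0 // => i _.
by rewrite mxE modulus0 expr0n.
Qed.

Lemma modulus_qform_le N (A : 'M[R[i]]_N) (u : 'cV[R[i]]_N) :
  \sum_s modulus (u s 0) ^+ 2 = 1 -> modulus (qform A u) <= opnorm A.
Proof.
move=> u1; have lu : l2norm u = 1 by rewrite /l2norm u1 sqrtr1.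
apply: le_trans (l2norm_mulmx_le A (v := u) _); last by rewrite lu.
have -> : qform A u = \sum_s ((u s 0)^*)%C * (A *m u) s 0.
  apply: eq_bigr => s _; rewrite mxE mulr_sumr; apply: eq_bigr => t _.
  by rewrite mulrA.
rewrite -(ler_pXn2r (ltn0Sn 1)) ?nnegrE ?modulus_ge0 ?l2norm_ge0 //.
apply: (@le_trans _ _ ((\sum_s modulus (u s 0) * modulus ((A *m u) s 0)) ^+ 2)).
  rewrite lerXn2r ?nnegrE ?modulus_ge0 //.
    by apply: sumr_ge0 => t _; rewrite mulr_ge0 ?modulus_ge0.
  apply: le_trans (modulus_sum _ _ _) _.
  by apply: ler_sum => t _; rewrite modulusM modulus_conj.
by apply: le_trans (sum_mul_sqr_le _ _ _) _; rewrite u1 mul1r l2norm_sqr.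
Qed.

Lemma qform_sum N (I : finType) (F : I -> 'M[R[i]]_N) c u :
  qform (\sum_i c i *: F i) u = \sum_i c i * qform (F i) u.
Proof.
rewrite /qform; under [RHS]eq_bigr do rewrite mulr_sumr.
rewrite [RHS]exchange_big; apply: eq_bigr => s _ /=.
under [RHS]eq_bigr do rewrite mulr_sumr.
rewrite [RHS]exchange_big; apply: eq_bigr => t _ /=.
rewrite summxE mulr_sumr mulr_suml; apply: eq_bigr => i _.
by rewrite mxE !mulrA [_ * c i]mulrC.
Qed.

End OperatorNorm.

Section TensorVectors.
Variables (R : realType) (K n : nat).

Definition tensor_vec (u : 'I_n -> 'I_K -> R[i]) : 'cV[R[i]]_#|{: {ffun 'I_n -> 'I_K}}| :=
  \col_s \prod_i u i ((enum_val s : {ffun 'I_n -> 'I_K}) i).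

Lemma sum_midx (V : nmodType) (F : {ffun 'I_n -> 'I_K} -> V) :
  \sum_(s < #|{: {ffun 'I_n -> 'I_K}}|) F (enum_val s) = \sum_s F s.
Proof. by rewrite -(big_enum_val (A := {: {ffun 'I_n -> 'I_K}}) F). Qed.

Lemma tensor_vec_unit u : (forall i, \sum_s modulus (u i s) ^+ 2 = 1) ->
  \sum_s modulus (tensor_vec u s 0) ^+ 2 = 1.
Proof.
move=> u1; under eq_bigr do rewrite mxE modulus_prod -prodrXl.
rewrite (sum_midx (fun s => \prod_i modulus (u i (s i)) ^+ 2)).
by rewrite -(bigA_distr_bigA (fun i s => modulus (u i s) ^+ 2)) big1.
Qed.

Lemma qform_tensor (B : 'I_n -> 'M[R[i]]_K) u :
  qform (tensor B) (tensor_vec u) =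
  \prod_i \sum_s \sum_t ((u i s)^*)%C * B i s t * u i t.
Proof.
rewrite bigA_distr_bigA /=.
under [RHS]eq_bigr do rewrite bigA_distr_bigA /=.
rewrite -[RHS]sum_midx; apply: eq_bigr => s _.
rewrite -[RHS]sum_midx; apply: eq_bigr => t _.
by rewrite !mxE rmorph_prod -!big_split.
Qed.

End TensorVectors.

(** * One tensor factor: eigenvectors and lines of [Z_K^2] *)

Section OneSite.
Variables (R : realType) (K : nat).

Lemma hwX_exp l (s t : 'I_K) :
  (hwX R K ^+ l) s t = (s == ((t + l) %% K)%N :> nat)%:R.
Proof.
elim: l s => [|l IHl] s.
  by rewrite expr0 -[1]/(1%:M) mxE addn0 modn_small.
have K0 : (0 < K)%N by apply: leq_trans (ltn_ord s).
rewrite exprS -[_ * _]/(_ *m _) mxE.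
have lt : ((t + l) %% K < K)%N by rewrite ltn_mod.
rewrite (bigD1 (Ordinal lt)) //= big1 => [|u]; last first.
  by rewrite IHl -val_eqE /= => /negbTE ->; rewrite mulr0.
rewrite addr0 IHl /= eqxx mulr1 mxE -val_eqE /=.
by rewrite -addn1 modnDml addn1 addnS.
Qed.

Lemma hwZ_exp m (s t : 'I_K) :
  (hwZ R K ^+ m) s t = (s == t)%:R * omega R K ^+ (t * m).
Proof.
elim: m s => [|m IHm] s.
  by rewrite expr0 -[1]/(1%:M) mxE muln0 expr0 mulr1.
rewrite exprS -[_ * _]/(_ *m _) mxE (bigD1 t) //= big1 => [|u ut]; last first.
  by rewrite IHm (negbTE ut) mul0r mulr0.
rewrite addr0 IHm eqxx mul1r !mxE; have [->|st] := eqVneq s t.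
  by rewrite !mulr1n mul1r mulnS exprD.
by rewrite mulr0n !mul0r.
Qed.

Lemma hw_site_entry l m (s t : 'I_K) :
  (hwX R K ^+ l *m hwZ R K ^+ m) s t =
  (s == ((t + l) %% K)%N :> nat)%:R * omega R K ^+ (t * m).
Proof.
rewrite mxE (bigD1 t) //= big1 => [|u ut]; last first.
  by rewrite hwZ_exp (negbTE ut) mul0r mulr0.
by rewrite addr0 hwX_exp hwZ_exp eqxx mul1r.
Qed.

Hypotheses (K_prime : prime K) (K_gt2 : (2 < K)%N).

Let K_gt0 : (0 < K)%N := prime_gt0 K_prime.

(** The increment under a shift by [l] is affine in [t], which is why the quadratic phase
    [omega ^+ (r * 'C(t, 2))] diagonalizes [X Z^r]. *)
Lemma bin2D t l : 'C(t + l, 2) = ('C(t, 2) + 'C(l, 2) + t * l)%N.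
Proof.
elim: t => [|t IHt]; first by rewrite mul0n addn0.
by rewrite addSn !binS !bin1 IHt mulSn; lia.
Qed.

(* Both facts need [K] odd. *)
Lemma dvdn_bin2_mul q : (K %| 'C(q * K, 2))%N.
Proof.
have cK2 : coprime K 2 by rewrite prime_coprime // dvdn_prime2 // gtn_eqF.
rewrite -(Gauss_dvdr _ cK2) -mul_bin_diag.
by rewrite dvdn_mulr // dvdn_mull.
Qed.

Lemma omega_mul_mod x y : omega R K ^+ (x * (y %% K)) = omega R K ^+ (x * y).
Proof. by rewrite -(omegaX_mod _ (x * y)) // -modnMmr omegaX_mod. Qed.

(** Makes the quadratic phase a function on [Z_K], so that the shift by [X] may wrap around. *)
Lemma omega_bin2_mod r i : omega R K ^+ (r * 'C(i %% K, 2)) = omega R K ^+ (r * 'C(i, 2)).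
Proof.
rewrite [in RHS](divn_eq i K) bin2D; apply/esym.
have /dvdnP[q ->] := dvdn_bin2_mul (i %/ K).
rewrite -(omegaX_mod _ (_ * _)%N) // -[in RHS]omegaX_mod //; congr (_ ^+ _).
rewrite !mulnDr mulnA -[(_ * K * _)%N]mulnA [(K * _)%N]mulnC !mulnA.
by rewrite -addnA modnMDl addnC modnMDl.
Qed.

(* The eigenvectors of [X Z^r] (for [Some r]) and of [Z] (for [None]) with
   eigenvalue [omega ^+ x]. *)
Definition eigenvector (c : option 'I_K) (x t : 'I_K) : R[i] :=
  if c is Some r then
    (Num.sqrt K%:R)^-1%:C *
      (omega R K ^+ (r * 'C(t, 2)) * omega R K ^- (x * t))
  else (t == x)%:R.

Arguments eigenvector : simpl never.

Lemma sqr_sqrt_nat : (Num.sqrt K%:R)^-1 ^+ 2 = K%:R^-1 :> R.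
Proof. by rewrite exprVn sqr_sqrtr. Qed.

Lemma eigenvector_unit c x : \sum_t modulus (eigenvector c x t) ^+ 2 = 1.
Proof.
case: c => [r|]; rewrite /eigenvector.
  under eq_bigr => t _.
    rewrite !modulusM modulusV !modulusX modulus_omega !expr1n invr1 !mulr1.
    rewrite modulus_real real_normK ?num_real // sqr_sqrt_nat.
    over.
  by rewrite sumr_const card_ord -[LHS]mulr_natr mulVf // pnatr_eq0 -lt0n.
rewrite (bigD1 x) //= eqxx modulus1 expr1n big1 ?addr0 // => t /negbTE ->.
by rewrite modulus0 expr0n.
Qed.

Definition bracket (c : option 'I_K) (x : 'I_K) (l m : nat) : R[i] :=
  \sum_s \sum_t ((eigenvector c x s)^*)%C *
    (hwX R K ^+ l *m hwZ R K ^+ m) s t * eigenvector c x t.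

(* The line through the origin of [Z_K^2] that contains [(l, m)], named by its
   slope, and the coordinate of [(l, m)] on it. *)
Definition line (l m : 'I_K) : option 'I_K :=
  if l == 0%N :> nat then None else [pick r : 'I_K | ((r * l) %% K == m)%N].

Definition coord (l m : 'I_K) : 'I_K := if l == 0%N :> nat then m else l.

(** As [K] is prime, multiplication by [l] is injective on [Z_K], hence bijective. *)
Lemma slopeP (l m : 'I_K) : l != 0%N :> nat ->
  exists2 r : 'I_K, line l m = Some r &
    forall r' : 'I_K, ((r' * l) %% K == m)%N = (r' == r).
Proof.
move=> l0.
have f_inj : injective (fun r : 'I_K => Ordinal (ltn_pmod (r * l) K_gt0)).
  have cop : coprime K l by rewrite prime_coprime // gtnNdvd // lt0n.
  have le_inj (r r' : 'I_K) : (r <= r')%N -> ((r * l) %% K = (r' * l) %% K)%N -> r = r'.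
    move=> rr' /esym/eqP; rewrite eqn_mod_dvd ?leq_mul2r ?rr' ?orbT //.
    rewrite -mulnBl Gauss_dvdl // => /dvdn_leq h; apply: val_inj => /=.
    apply/eqP; rewrite eqn_leq rr' /= -subn_eq0 -leqn0 leqNgt.
    by apply/negP => /h; have := ltn_ord r'; lia.
  move=> r r' /(congr1 val) /= E; have [|/ltnW] := leqP r r'.
    by move=> /le_inj; apply.
  by move=> /le_inj h; apply/esym/h.
have [g fg gf] := injF_bij f_inj.
have gE (r' : 'I_K) : ((r' * l) %% K == m)%N = (r' == g m).
  by rewrite -(inj_eq f_inj) gf -val_eqE.
exists (g m) => //; rewrite /line (negbTE l0).
by case: pickP => [r|/(_ (g m))]; rewrite gE ?eqxx // => /eqP ->.
Qed.

(** The ratio of [X^l Z^(r l)] to [(X Z^r)^l]. *)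
Definition phase (l m : 'I_K) : R[i] :=
  if line l m is Some r then omega R K ^- (r * 'C(l, 2)) else 1.

Lemma modulus_phase l m : modulus (phase l m) = 1.
Proof.
rewrite /phase; case: line => [r|]; last exact: modulus1.
by rewrite modulusV modulusX modulus_omega expr1n invr1.
Qed.

Lemma conj_eigenvector (r x t : 'I_K) : ((eigenvector (Some r) x t)^*)%C =
  (Num.sqrt K%:R)^-1%:C * (omega R K ^- (r * 'C(t, 2)) * omega R K ^+ (x * t)).
Proof.
have conjcM (a b : R[i]) : ((a * b)^*)%C = (a^*)%C * (b^*)%C by exact: rmorphM.
rewrite /eigenvector !conjcM conjc_real conj_omegaX.
by rewrite -[omega R K ^- (x * t)]conj_omegaX conjcK.
Qed.

(** Column [t] meets only row [t + l], and the product there is a constant times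
    [omega ^ ((m - r l) t)]; summing over [t] kills it off the line of slope [r]. *)
Lemma bracket_Some (r x l m : 'I_K) : bracket (Some r) x l m =
  if ((r * l) %% K == m)%N then
    omega R K ^- (r * 'C(l, 2)) * omega R K ^+ (x * l) else 0.
Proof.
have nz k : omega R K ^+ k != 0 by rewrite expf_neq0 ?omega_neq0.
have sum_s (t : 'I_K) : \sum_s ((eigenvector (Some r) x s)^*)%C *
    (hwX R K ^+ l *m hwZ R K ^+ m) s t * eigenvector (Some r) x t =
    K%:R^-1 * (omega R K ^- (r * 'C(l, 2)) * omega R K ^+ (x * l)) *
      (omega R K ^+ (m * t) * omega R K ^- ((r * l) %% K * t)).
  have lt : ((t + l) %% K < K)%N by rewrite ltn_mod.
  rewrite (bigD1 (Ordinal lt)) //= [X in _ + X]big1 => [|u]; last first.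
    by rewrite hw_site_entry -val_eqE => /negbTE /= ->; rewrite mul0r mulr0 mul0r.
  rewrite addr0 hw_site_entry /= eqxx mul1r conj_eigenvector /= omega_mul_mod.
  rewrite omega_bin2_mod bin2D [((r * l) %% K * t)%N]mulnC omega_mul_mod.
  have -> : K%:R^-1 = (Num.sqrt K%:R)^-1%:C * (Num.sqrt K%:R)^-1%:C :> R[i].
    by rewrite -rmorphM /= -expr2 sqr_sqrt_nat fmorphV rmorph_nat.
  rewrite !mulnDr !exprD [(m * t)%N]mulnC (mulnCA t r l).
  rewrite /eigenvector; move: ((Num.sqrt K%:R)^-1%:C) => q.
  by field; rewrite !nz.
rewrite /bracket exchange_big (eq_bigr _ (fun t _ => sum_s t)) -mulr_sumr.
rewrite sum_omega_orthogonal ?ltn_mod // eq_sym; case: eqP => _; last by rewrite mulr0.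
by rewrite mulrAC mulVf ?mul1r // pnatr_eq0 -lt0n.
Qed.

Lemma bracket_None (x l m : 'I_K) : bracket None x l m =
  if l == 0%N :> nat then omega R K ^+ (x * m) else 0.
Proof.
rewrite /bracket (bigD1 x) //= [X in _ + X]big1 => [|s /negbTE sx]; last first.
  by rewrite big1 // => t _; rewrite /eigenvector sx conjc0 !mul0r.
rewrite addr0 (bigD1 x) //= [X in _ + X]big1 => [|t /negbTE tx]; last first.
  by rewrite /eigenvector tx mulr0.
rewrite addr0 /eigenvector eqxx conjc1 mul1r mulr1 hw_site_entry.
have -> : (x == ((x + l) %% K)%N :> nat) = (l == 0%N :> nat).
  transitivity (x + 0 == x + l %[mod K])%N.
    by rewrite addn0 [(x %% K)%N]modn_small.
  by rewrite eqn_modDl mod0n modn_small // eq_sym.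
by case: ifP => _; rewrite ?mul1r ?mul0r.
Qed.

(** The origin has its own case since it lies on all the lines, whereas [line] names only one. *)
Lemma bracketE c (x l m : 'I_K) : bracket c x l m =
  if (l == 0%N :> nat) && (m == 0%N :> nat) then 1
  else if line l m == c then phase l m * omega R K ^+ (x * coord l m) else 0.
Proof.
case: c => [r|]; last first.
  rewrite bracket_None /phase /coord; have [l0|l0] := eqVneq (l : nat) 0%N.
    rewrite /line l0 /= mul1r.
    by case: eqP => // ->; rewrite muln0 expr0.
  by rewrite /= ; have [r ->] := slopeP m l0.
rewrite bracket_Some; have [l0|l0] := eqVneq (l : nat) 0%N.
  rewrite l0 muln0 mod0n eq_sym /line l0 /=.
  by case: ifP => // _; rewrite !muln0 expr0 invr1 mul1r.
rewrite /phase /coord (negbTE l0) /=; have [r0 -> rP] := slopeP m l0.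
rewrite rP eq_sym; have [[<-]|] := eqVneq (Some r0) (Some r); first by rewrite eqxx.
by move=> ne; rewrite ifN //; apply: contra_neq ne => ->.
Qed.

Lemma coord_eq0 (l m : 'I_K) : coord l m = 0%N :> nat -> (l = 0%N :> nat) /\ (m = 0%N :> nat).
Proof. by rewrite /coord; case: ifPn => [/eqP ->|/eqP]. Qed.

Lemma coord_line_inj (l m l' m' : 'I_K) : coord l m = coord l' m' ->
  line l m = line l' m' -> l = l' /\ m = m'.
Proof.
rewrite /coord; have [l0|l0] := eqVneq (l : nat) 0%N;
  have [l'0|l'0] := eqVneq (l' : nat) 0%N.
- by move=> -> _; split=> //; apply: val_inj; rewrite /= l0 l'0.
- by have [r ->] := slopeP m' l'0; rewrite /line l0.
- by have [r ->] := slopeP m l0; rewrite /line l'0.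
move=> ll; subst l' => lines; split=> //.
have [r lr rP] := slopeP m l0; have [r' lr' rP'] := slopeP m' l'0.
move: lines; rewrite lr lr' => -[rr]; apply: val_inj => /=.
have /eqP <- : ((r * l) %% K == m)%N by rewrite rP.
by apply/eqP; rewrite rP' rr.
Qed.

End OneSite.

(** * From [n] sites to a polynomial in [n (K + 1)] variables *)

Section Reduction.
Variables (R : realType) (K n : nat).
Hypotheses (K_prime : prime K) (K_gt2 : (2 < K)%N).

Let K_gt0 : (0 < K)%N := prime_gt0 K_prime.

Notation site := ('I_n * option 'I_K)%type.
Notation lm_index := ({ffun 'I_n -> 'I_K} * {ffun 'I_n -> 'I_K})%type.

(* The exponent, on the variables [z_(j, c)], of the monomial to which
   [X^l Z^m] contributes. *)
Definition monomial (lm : lm_index) : {ffun 'I_#|{: site}| -> 'I_K} :=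
  [ffun i => let: (j, c) := enum_val i in
     if line (lm.1 j) (lm.2 j) == c then coord (lm.1 j) (lm.2 j)
     else Ordinal K_gt0].

Lemma monomialE lm j c : monomial lm (enum_rank (j, c)) =
  if line (lm.1 j) (lm.2 j) == c then coord (lm.1 j) (lm.2 j)
  else Ordinal K_gt0.
Proof. by rewrite ffunE enum_rankK. Qed.

Lemma big_site (T : Type) (idx : T) (op : Monoid.com_law idx) (F : site -> T) :
  \big[op/idx]_(i < #|{: site}|) F (enum_val i) =
  \big[op/idx]_j \big[op/idx]_c F (j, c).
Proof. by rewrite -(big_enum_val (A := {: site})) pair_bigA; apply: eq_bigr => -[]. Qed.

Lemma monomial_inj : injective monomial.
Proof.
move=> [l m] [l' m'] E.
suff h j : l j = l' j /\ m j = m' j.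
  by congr (_, _); apply/ffunP => j; have [] := h j.
have Ec c : (if line (l j) (m j) == c then coord (l j) (m j) else Ordinal K_gt0) =
    (if line (l' j) (m' j) == c then coord (l' j) (m' j) else Ordinal K_gt0).
  by have /ffunP/(_ (enum_rank (j, c))) := E; rewrite !monomialE.
have [ll|ll] := eqVneq (line (l j) (m j)) (line (l' j) (m' j)).
  apply: (coord_line_inj K_prime) => //.
  by have := Ec (line (l j) (m j)); rewrite -ll eqxx.
(* On different lines the two monomials use different variables, so both exponents vanish and both
   points are the origin. *)
have c0 : coord (l j) (m j) = 0%N :> nat.
  by have := Ec (line (l j) (m j)); rewrite eqxx eq_sym (negbTE ll) => ->.
have c'0 : coord (l' j) (m' j) = 0%N :> nat.
  by have := Ec (line (l' j) (m' j)); rewrite eqxx (negbTE ll) => <-.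
have [l0 m0] := coord_eq0 c0; have [l'0 m'0] := coord_eq0 c'0.
by split; apply: val_inj; rewrite /= ?l0 ?m0 ?l'0 ?m'0.
Qed.

Lemma sum_monomial lm : (\sum_i monomial lm i = \sum_(j < n) coord (lm.1 j) (lm.2 j))%N.
Proof.
pose F (jc : site) : nat := if line (lm.1 jc.1) (lm.2 jc.1) == jc.2
  then nat_of_ord (coord (lm.1 jc.1) (lm.2 jc.1)) else 0%N.
rewrite (eq_bigr (fun i => F (enum_val i))) => [|i _]; last first.
  by rewrite ffunE /F; case: (enum_val i) => j c /=; case: ifP.
rewrite big_site; apply: eq_bigr => j _.
rewrite (bigD1 (line (lm.1 j) (lm.2 j))) //= big1 => [|c /negbTE lc].
  by rewrite /F eqxx addn0.
by rewrite /F /= eq_sym lc.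
Qed.

Lemma prod_monomial lm (x : site -> 'I_K) :
  \prod_i (omega R K ^+ x (enum_val i)) ^+ monomial lm i =
  \prod_j omega R K ^+ (x (j, line (lm.1 j) (lm.2 j)) * coord (lm.1 j) (lm.2 j)).
Proof.
pose F (jc : site) := omega R K ^+ (x jc * if line (lm.1 jc.1) (lm.2 jc.1) == jc.2
  then nat_of_ord (coord (lm.1 jc.1) (lm.2 jc.1)) else 0%N).
rewrite (eq_bigr (fun i => F (enum_val i))) => [|i _]; last first.
  rewrite -exprM ffunE /F; congr (_ ^+ (_ * _)%N).
  by case: (enum_val i) => j c /=; case: ifP.
rewrite big_site; apply: eq_bigr => j _.
rewrite (bigD1 (line (lm.1 j) (lm.2 j))) //= big1 => [|c /negbTE lc].
  by rewrite /F eqxx mulr1.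
by rewrite /F /= eq_sym lc muln0 expr0.
Qed.

Definition nontrivial (lm : lm_index) : {set 'I_n} :=
  [set j | (lm.1 j + lm.2 j != 0)%N].

Definition site_coef (l m : 'I_K) : R[i] :=
  if (l + m == 0)%N then 1 else K.+1%:R^-1 * phase R l m.

(** All [K + 1] terms equal 1 at the origin; elsewhere just the term of the line through [(l, m)]
    survives. *)
Lemma average_bracket (x : option 'I_K -> 'I_K) (l m : 'I_K) :
  K.+1%:R^-1 * \sum_c bracket R c (x c) l m =
  site_coef l m * omega R K ^+ (x (line l m) * coord l m).
Proof.
rewrite /site_coef addn_eq0; case: ifP => lm0.
  rewrite (eq_bigr (fun=> 1)) => [|c _]; last by rewrite bracketE // lm0.
  rewrite sumr_const card_option card_ord mulVf ?pnatr_eq0 // mul1r.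
  by move: lm0 => /andP[/eqP l0 /eqP m0]; rewrite /coord l0 eqxx m0 muln0 expr0.
rewrite (bigD1 (line l m)) //= big1 => [|c /negbTE lc].
  by rewrite addr0 bracketE // lm0 eqxx mulrA.
by rewrite bracketE // lm0 eq_sym lc.
Qed.

Lemma modulus_site_coef l m :
  modulus (site_coef l m) = if (l + m == 0)%N then 1 else K.+1%:R^-1.
Proof.
rewrite /site_coef; case: ifP => _; first exact: modulus1.
by rewrite modulusM modulusV modulus_nat modulus_phase mulr1.
Qed.

Implicit Types (d : nat) (Ahat : lm_index -> R[i]).

Definition coef (Ahat : lm_index -> R[i]) (lm : lm_index) : R[i] :=
  Ahat lm * \prod_j site_coef (lm.1 j) (lm.2 j).

(** By [monomial_inj] the sum has at most one term; it is empty, hence 0, off the image of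
    [monomial]. *)
Definition cyclic_coef (Ahat : lm_index -> R[i])
    (beta : {ffun 'I_#|{: site}| -> 'I_K}) : R[i] :=
  \sum_(lm | monomial lm == beta) coef Ahat lm.

Lemma cyclic_coef_monomial Ahat lm : cyclic_coef Ahat (monomial lm) = coef Ahat lm.
Proof.
by rewrite /cyclic_coef (eq_bigl (pred1 lm)) ?big_pred1_eq // => lm';
  rewrite /= (inj_eq monomial_inj).
Qed.

(** At each site [coord] is [l] or [m], so at most [l + m], and a nontrivial site contributes at
    least 1 to the degree. *)
Lemma low_degree_monomial d Ahat lm : hw_degree d Ahat -> Ahat lm != 0 ->
  low_degree d (monomial lm) && (#|nontrivial lm| <= d)%N.
Proof.
case: lm => l m hd A0.
have deg : (\sum_(i < n) (l i + m i) <= d)%N.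
  by rewrite leqNgt; apply: contra_neqN A0 => /hd.
rewrite /low_degree sum_monomial /=; apply/andP; split; apply: leq_trans deg.
  apply: leq_sum => j _; rewrite /coord.
  by case: ifP => _; rewrite ?leq_addl ?leq_addr.
rewrite -sum1_card big_mkcond; apply: leq_sum => j _.
by rewrite inE /= -lt0n; case: ifP.
Qed.

(** A factor [K + 1] is lost only at the nontrivial sites, of which there are at most [d] whatever
    [n] is. *)
Lemma modulus_coef_ge d Ahat lm : hw_degree d Ahat ->
  modulus (Ahat lm) <= K.+1%:R ^+ d * modulus (coef Ahat lm).
Proof.
move=> hd; have [A0|A0] := eqVneq (Ahat lm) 0.
  by rewrite A0 modulus0 mulr_ge0 ?exprn_ge0 ?modulus_ge0.
have /andP[_ nd] := low_degree_monomial hd A0.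
rewrite /coef modulusM mulrCA ler_peMr ?modulus_ge0 // modulus_prod.
rewrite (bigID (fun j => j \in nontrivial lm)) /= [X in _ * (_ * X)]big1 => [|j].
  rewrite mulr1 (eq_bigr (fun=> K.+1%:R^-1)) => [|j]; last first.
    by rewrite inE modulus_site_coef => /negbTE ->.
  rewrite prodr_const exprVn ler_pdivlMr ?exprn_gt0 // mul1r.
  by rewrite ler_eXn2l // ltr1n.
by rewrite inE negbK modulus_site_coef => ->.
Qed.

Lemma poly_eval_cyclic_coef d Ahat A (x : site -> 'I_K) :
  hw_expansion A Ahat -> hw_degree d Ahat ->
  poly_eval d (cyclic_coef Ahat) (fun i => omega R K ^+ x (enum_val i)) =
  (K.+1%:R^-1) ^+ n * \sum_(c : {ffun 'I_n -> option 'I_K})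
    qform A (tensor_vec (fun j => eigenvector R (c j) (x (j, c j)))).
Proof.
move=> hA hd.
have -> : poly_eval d (cyclic_coef Ahat) (fun i => omega R K ^+ x (enum_val i)) =
    \sum_lm coef Ahat lm * \prod_i (omega R K ^+ x (enum_val i)) ^+ monomial lm i.
  rewrite [RHS](bigID (fun lm => low_degree d (monomial lm))) /=.
  rewrite [X in _ = _ + X]big1 ?addr0 => [|lm].
    rewrite (partition_big monomial (low_degree d)) //=.
    apply: eq_bigr => beta lb; rewrite /cyclic_coef mulr_suml.
    apply: eq_big => [lm|lm /eqP -> //].
    by case: eqP => [->|]; rewrite ?andbF ?lb.
  apply: contraNeq; rewrite /coef mulf_eq0 negb_or mulf_eq0 negb_or.
  by move=> /andP[/andP[A0 _] _]; have /andP[] := low_degree_monomial hd A0.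
have -> : A = \sum_(lm : lm_index) Ahat lm *: heisenberg_weyl R lm.1 lm.2.
  by rewrite hA pair_bigA; apply: eq_bigr => -[].
under [in RHS]eq_bigr do rewrite qform_sum.
rewrite exchange_big mulr_sumr; apply: eq_bigr => lm _ /=.
rewrite -mulr_sumr mulrCA /coef -mulrA; congr (_ * _).
under [in RHS]eq_bigr do rewrite qform_tensor.
(* On product vectors the sum over all choices of lines splits into one average per site. *)
rewrite -(bigA_distr_bigA (fun j c => bracket R c (x (j, c)) (lm.1 j) (lm.2 j))).
rewrite -[X in _ = _ ^+ X * _]card_ord -prodr_const -big_split prod_monomial -big_split.
by apply: eq_bigr => j _; rewrite /= (average_bracket (fun c => x (j, c))).
Qed.

Lemma Omega_supnorm_cyclic_coef_le d Ahat A :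
  hw_expansion A Ahat -> hw_degree d Ahat ->
  Omega_supnorm d (cyclic_coef Ahat) <= opnorm A.
Proof.
move=> hA hd; apply: ge_sup.
  exists (modulus (poly_eval d (cyclic_coef Ahat) (fun=> 1))), (fun=> 1) => // i.
  by exists 0%N; rewrite //= expr0.
move=> _ [z /= Oz <-].
have /choice[x xz] : forall i, exists x : 'I_K, z i = omega R K ^+ x.
  by move=> i; have [j /= jK <-] := Oz i; exists (Ordinal jK).
have -> : z = fun i => omega R K ^+ (fun jc => x (enum_rank jc)) (enum_val i).
  by apply/funext => i; rewrite /= enum_valK xz.
rewrite (poly_eval_cyclic_coef (fun jc => x (enum_rank jc)) hA hd).
rewrite modulusM modulusX modulusV modulus_nat exprVn ler_pdivrMl ?exprn_gt0 ?ltr0n //.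
apply: le_trans (modulus_sum _ _ _) _.
have -> : K.+1%:R ^+ n * opnorm A = \sum_(c : {ffun 'I_n -> option 'I_K}) opnorm A.
  by move: (opnorm A) => B; rewrite sumr_const card_ffun card_option !card_ord -natrX mulr_natl.
apply: ler_sum => c _; apply: modulus_qform_le; apply: tensor_vec_unit => j.
exact: eigenvector_unit.
Qed.

Lemma lpnorm_cyclic_coef_ge d Ahat : (0 < d)%N -> hw_degree d Ahat ->
  lpnorm (bh_exponent R d) predT Ahat <=
  K.+1%:R ^+ d * lpnorm (bh_exponent R d) (@low_degree K _ d) (cyclic_coef Ahat).
Proof.
move=> d0 hd; set p := bh_exponent R d.
have p_gt0 : 0 < p by apply: lt_le_trans (bh_exponent_ge1 R d0).
have p0 : p != 0 by rewrite gt_eqF.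
set M := K.+1%:R ^+ d; have M0 : 0 <= M :> R by apply: exprn_ge0.
have -> : M = (M `^ p) `^ p^-1 by rewrite -powRrM divff // powRr1.
rewrite /lpnorm -powRM ?powR_ge0 //; last by apply: sumr_ge0 => *; apply: powR_ge0.
apply: ge0_ler_powR; rewrite ?invr_ge0 ?(ltW p_gt0) ?nnegrE //.
- by apply: sumr_ge0 => *; apply: powR_ge0.
- by rewrite mulr_ge0 ?powR_ge0 //; apply: sumr_ge0 => *; apply: powR_ge0.
rewrite mulr_sumr.
apply: (@le_trans _ _ (\sum_(lm | low_degree d (monomial lm))
    M `^ p * modulus (cyclic_coef Ahat (monomial lm)) `^ p)).
  rewrite [leLHS](bigID (fun lm => low_degree d (monomial lm))) /=.
  rewrite [X in _ + X]big1 ?addr0 => [|lm nl]; last first.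
    have [->|A0] := eqVneq (Ahat lm) 0; first by rewrite modulus0 powR0.
    by have /andP[] := low_degree_monomial hd A0; rewrite (negbTE nl).
  apply: ler_sum => lm _; rewrite -powRM ?modulus_ge0 //.
  apply: ge0_ler_powR; rewrite ?nnegrE ?mulr_ge0 ?modulus_ge0 ?(ltW p_gt0) //.
  by rewrite cyclic_coef_monomial modulus_coef_ge.
(* The fibres of [monomial] have at most one element, so the coefficients of [A] inject into those
   of the polynomial. *)
rewrite (partition_big monomial (low_degree d)) //=.
apply: ler_sum => beta lb.
have G0 : 0 <= M `^ p * modulus (cyclic_coef Ahat beta) `^ p.
  by rewrite mulr_ge0 ?powR_ge0.
case: (pickP [pred lm | monomial lm == beta]) => [lm0 /eqP lmb|none]; last first.
  by rewrite big1 // => lm /andP[_ h]; have := none lm; rewrite /= h.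
rewrite (big_pred1 lm0) ?lmb // => lm.
by rewrite /= -lmb (inj_eq monomial_inj); case: eqP => [->|]; rewrite ?andbF // lmb lb.
Qed.

End Reduction.

(** * Transfer of constants and conclusion *)

Section Main.
Variable R : realType.

(** Tested on the constant polynomial 1 in one variable, whose supremum norm is positive. *)
Lemma cyclic_bh_bound_ge0 (K d : nat) (C : R) : (0 < K)%N ->
  cyclic_bh_bound K d C -> 0 <= C.
Proof.
move=> K0 hC; pose a (al : {ffun 'I_1 -> 'I_K}) : R[i] :=
  if al == [ffun=> Ordinal K0] then 1 else 0.
have := hC 1%N a isT.
have lp : 0 <= lpnorm (bh_exponent R d) (@low_degree K 1 d) a by apply: powR_ge0.
move=> /(le_trans lp); rewrite pmulr_lge0 //.
apply: (@lt_le_trans _ _ (modulus (poly_eval d a (fun=> 1)))); last first.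
  by apply: modulus_poly_eval_le => j; exists 0%N; rewrite //= expr0.
rewrite /poly_eval (bigD1 [ffun=> Ordinal K0]) /=; last first.
  by rewrite /low_degree big1 // => j _; rewrite ffunE.
rewrite /a eqxx big1 => [|j _]; last by rewrite expr1n.
rewrite big1 => [|al /andP[_ /negbTE ->]]; last by rewrite mul0r.
by rewrite mulr1 addr0 modulus1.
Qed.

Lemma hw_bh_of_cyclic (K d : nat) (C : R) : prime K -> (2 < K)%N -> (0 < d)%N ->
  cyclic_bh_bound K d C -> hw_bh_bound K d (K.+1%:R ^+ d * C).
Proof.
move=> K_prime K_gt2 d0 hC n A Ahat n0 hA hd.
apply: le_trans (lpnorm_cyclic_coef_ge K_prime K_gt2 d0 hd) _.
rewrite -mulrA ler_wpM2l ?exprn_ge0 //.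
have N0 : (1 <= #|{: 'I_n * option 'I_K}|)%N.
  by rewrite card_prod card_option !card_ord muln_gt0 n0.
apply: le_trans (hC _ _ N0) _.
rewrite ler_wpM2l ?(cyclic_bh_bound_ge0 (prime_gt0 K_prime) hC) //.
exact: Omega_supnorm_cyclic_coef_le.
Qed.

Lemma hw_bh_bound_le (K d : nat) (C C' : R) : C <= C' ->
  hw_bh_bound K d C -> hw_bh_bound K d C'.
Proof.
move=> CC' hC n A Ahat n0 hA hd; apply: le_trans (hC _ _ _ n0 hA hd) _.
by rewrite ler_wpM2r ?opnorm_ge0.
Qed.

(** [1040 = 20 * 26 * 2], where 20 absorbs [5 * 2 ^ d.+1] and 2 absorbs [d ^ d <= 2 ^ (d ^ 2)], the
    factor that calls for the exponent [d ^ 2]. *)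
Lemma bh_constant_le (K d : nat) : (0 < d)%N ->
  (K.+1 ^ d * (5 * 2 ^ d.+1 * (26 * K * d) ^ d) <=
   (1040 * K * K.+1) ^ (d ^ 2))%N.
Proof.
move=> d0; have [->|K0] := posnP K.
  by rewrite muln0 mul0n exp0n // !muln0.
have dd : (d ^ d <= 2 ^ (d ^ 2))%N.
  by rewrite expnS expn1 expnM leq_exp2r // ltnW // ltn_expl.
have mono x : (0 < x)%N -> (x ^ d <= x ^ (d ^ 2))%N.
  by move=> x0; rewrite leq_pexp2l // expnS expn1 leq_pmulr.
have h5 : (5 * 2 ^ d.+1 <= 20 ^ d)%N.
  rewrite expnS (_ : 20 = 10 * 2)%N // expnMn mulnA leq_mul2r.
  by rewrite (leq_trans (_ : _ <= 10 ^ 1)%N) ?orbT // leq_pexp2l.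
apply: (@leq_trans ((1040 * K * K.+1) ^ (d ^ 2))%N) => //.
rewrite (_ : 1040 * K * K.+1 = K.+1 * (20 * (26 * K * 2)))%N; last by lia.
rewrite !(expnMn _ _ (d ^ 2)) leq_mul ?mono // leq_mul //.
  by rewrite (leq_trans h5) ?mono.
by rewrite !expnMn leq_mul // -!expnMn mono // muln_gt0.
Qed.

(** By [cyclic_bh] the set of admissible constants is nonempty, and it is bounded below by 0, so its
    infimum is real; this infimum is itself admissible. *)
Lemma hw_bh_bound_inf (K d : nat) : prime K -> (2 < K)%N -> (0 < d)%N ->
  exists C : R, (C%:E <= (K.+1%:R ^+ d)%:E * BH_Omega R K d)%E /\ hw_bh_bound K d C.
Proof.
move=> K_prime K_gt2 d0; have K0 := prime_gt0 K_prime.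
have hC0 := @cyclic_bh R K d K0 d0; set C0 := 5 * _ * _ in hC0.
pose S : set R := [set C : R | cyclic_bh_bound K d C]%classic.
have S_inf : has_inf S.
  by split; [exists C0|exists 0 => C; apply: cyclic_bh_bound_ge0].
have -> : BH_Omega R K d = (inf S)%:E.
  by rewrite /BH_Omega ereal_inf_EFin //; case: S_inf.
exists (K.+1%:R ^+ d * inf S); split; first by rewrite EFinM.
apply: hw_bh_of_cyclic => // n a n0.
have B0 := Omega_supnorm_ge0 d a K0.
(* For a positive supremum norm the quotient is a lower bound of all admissible constants; for a
   zero one the explicit constant [C0] already gives 0. *)
have [Bp|] := ltP 0 (Omega_supnorm d a); last first.
  move=> Bn; have B00 : Omega_supnorm d a = 0 by apply/eqP; rewrite eq_le Bn B0.
  by have := hC0 n a n0; rewrite B00 !mulr0.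
rewrite -ler_pdivrMr //; apply: lb_le_inf; first by case: S_inf.
by move=> C hC; rewrite ler_pdivrMr //; apply: hC.
Qed.

End Main.

Theorem theorem4 (R : realType) (K : nat) (K_prime : prime K)
    (K_gt2 : (2 < K)%N) :
  (forall d : nat, (1 <= d)%N ->
     exists C : R,
       (C%:E <= ((K.+1)%:R ^+ d)%:E * BH_Omega R K d)%E /\
       hw_bh_bound K d C) /\
  (exists CK : R, 0 < CK /\
     forall d : nat, (1 <= d)%N -> hw_bh_bound K d (CK ^+ (d ^ 2)%N)).
Proof.
have K0 := prime_gt0 K_prime.
split=> [d d0|]; first exact: hw_bh_bound_inf.
exists (1040 * K * K.+1)%:R; split=> [|d d0]; first by rewrite ltr0n !muln_gt0 K0.
apply: (hw_bh_bound_le _ (hw_bh_of_cyclic K_prime K_gt2 d0 (cyclic_bh (R := R) K0 d0))).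
by rewrite -!natrX -!natrM ler_nat; apply: bh_constant_le.
Qed.
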